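(* Let $T$ be any finite tree with at least one internal vertex (vertex of degree greater than one) in which every internal vertex has even degree greater than two. Then $T$ can be realized as the truncated graph of a global flat folding; that is, there exists a global flat folding $\varphi:\mathbb{R}^2\to\mathbb{R}^2$ whose truncated graph is isomorphic to $T$.
   Context: Local flat folding: a continuous function $\varphi:\mathbb{R}^2\to\mathbb{R}^2$ such that every point $p$ of the plane is of one of the following three types, and at least one point is a vertex point (the number of vertex points is not required to be finite). (1) Unfolded point: $p$ has a neighborhood mapped by $\varphi$ in a distance-preserving way. (2) Crease point: $p$ has a neighborhood $N$ that can be covered by two subsets, each containing $p$ and each mapped by $\varphi$ in a different distance-preserving way. (Necessarily the boundary between the subsets is a line through $p$, and the two isometries are reflections of each other across the image of this line; points of $N$ on this line are also crease points and the other points of $N$ are unfolded points.) (3) Vertex point: $p$ has a neighborhood $N$ that can be covered by finitely many (at least three) subsets, each containing $p$ and each mapped by $\varphi$ in a distance-preserving way, with at least three distinct isometries among these subsets. (Necessarily each subset is a wedge with apex $p$; points of $N$ other than $p$ on the rays between pairs of wedges are crease points and the remaining points of $N$ other than $p$ are unfolded points.) Global flat folding: a local flat folding $\varphi$ such that for every $\epsilon>0$ there exists a topological embedding $\varphi_\epsilon:\mathbb{R}^2\to\mathbb{R}^3$ (without self-intersections) such that, with $\pi:\mathbb{R}^3\to\mathbb{R}^2$ the coordinatewise vertical projection, $\pi(\varphi_\epsilon(p))$ is within distance $\epsilon$ of $\varphi(p)$ for every point $p$. Truncated graph of a local flat folding: the graph with one vertex for each vertex point and one additional vertex for each ray of crease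 points (a ray whose apex is a vertex point and all of whose other points are crease points). Two vertex points are adjacent when the line segment between them consists (apart from its endpoints) only of crease points; and the additional vertex of each ray of crease points is adjacent to the vertex point at the apex of that ray (these are the only edges). *)

(* Defs.v *)
From HB Require Import structures.
From mathcomp Require Import all_boot all_order all_algebra.
From mathcomp Require Import all_classical all_reals all_analysis.

Set Implicit Arguments.
Unset Strict Implicit.
Unset Printing Implicit Defensive.

Import Order.TTheory GRing.Theory Num.Theory.
Import numFieldNormedType.Exports.

Local Open Scope classical_set_scope.
Local Open Scope ring_scope.

(* The norm that MathComp-Analysis puts on 'rV[R]_n is the sup norm; it induces
   the usual topology, but isometries have to be taken for the Euclidean
   distance. *)
Definition edist (R : realType) (n : nat) (x y : 'rV[R]_n) : R :=
  Num.sqrt (\sum_(i < n) (x 0 i - y 0 i) ^+ 2).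

Definition isometry_on (R : realType) (A : set 'rV[R]_2)
    (f : 'rV[R]_2 -> 'rV[R]_2) : Prop :=
  forall x y, A x -> A y -> edist (f x) (f y) = edist x y.

(* A distance-preserving map defined on a subset of the plane is the restriction
   of an isometry f of the whole plane; "the way" in which phi maps A is such
   an f. *)
Definition mapped_by (R : realType) (phi : 'rV[R]_2 -> 'rV[R]_2)
    (A : set 'rV[R]_2) (f : 'rV[R]_2 -> 'rV[R]_2) : Prop :=
  isometry_on setT f /\ (forall x, A x -> phi x = f x).

Definition unfolded_point (R : realType) (phi : 'rV[R]_2 -> 'rV[R]_2)
    (p : 'rV[R]_2) : Prop :=
  exists N : set 'rV[R]_2, nbhs p N /\ isometry_on N phi.

(* The three types of points are meant to be mutually exclusive.  Without the
   explicit exclusions, the subset [set p], which is mapped by every isometry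
   sending p to phi p, could be added to any covering, and every unfolded point
   would also be a crease point and a vertex point.  With them, phi is
   forced to coincide near p with two isometries on the two sides of a line
   through p (resp. with isometries on wedges of apex p). *)
Definition crease_point (R : realType) (phi : 'rV[R]_2 -> 'rV[R]_2)
    (p : 'rV[R]_2) : Prop :=
  ~ unfolded_point phi p /\
  exists (N A B : set 'rV[R]_2) (f g : 'rV[R]_2 -> 'rV[R]_2),
    [/\ nbhs p N,
        N = A `|` B,
        A p /\ B p,
        mapped_by phi A f /\ mapped_by phi B g
      & f <> g].

Definition vertex_point (R : realType) (phi : 'rV[R]_2 -> 'rV[R]_2)
    (p : 'rV[R]_2) : Prop :=
  [/\ ~ unfolded_point phi p,
      ~ crease_point phi p
    & exists (N : set 'rV[R]_2) (k : nat) (A : 'I_k -> set 'rV[R]_2)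
             (f : 'I_k -> 'rV[R]_2 -> 'rV[R]_2),
        [/\ nbhs p N,
            (3 <= k)%N /\ N = \bigcup_i A i,
            (forall i, A i p),
            (forall i, mapped_by phi (A i) (f i))
          & exists i j l, [/\ f i <> f j, f i <> f l & f j <> f l]]].

Definition local_flat_folding (R : realType)
    (phi : 'rV[R]_2 -> 'rV[R]_2) : Prop :=
  [/\ continuous phi,
      (forall p, [\/ unfolded_point phi p, crease_point phi p
                   | vertex_point phi p])
    & exists p, vertex_point phi p].

Definition topological_embedding (X Y : topologicalType) (f : X -> Y) : Prop :=
  [/\ continuous f,
      injective f
    & forall U : set X, open U ->
        exists W : set Y, open W /\ f @` U = W `&` range f].

Definition vertical_proj (R : realType) (x : 'rV[R]_3) : 'rV[R]_2 :=
  \row_(j < 2) x 0 (widen_ord (leqnSn 2) j).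

Definition global_flat_folding (R : realType)
    (phi : 'rV[R]_2 -> 'rV[R]_2) : Prop :=
  local_flat_folding phi /\
  forall eps : R, 0 < eps ->
    exists phi_eps : 'rV[R]_2 -> 'rV[R]_3,
      topological_embedding phi_eps /\
      forall p, edist (vertical_proj (phi_eps p)) (phi p) <= eps.

Definition ray_from (R : realType) (a : 'rV[R]_2) (r : set 'rV[R]_2) : Prop :=
  exists2 u : 'rV[R]_2, u != 0 & r = [set a + t *: u | t in [set t : R | 0 <= t]].

Definition crease_ray (R : realType) (phi : 'rV[R]_2 -> 'rV[R]_2)
    (r : set 'rV[R]_2) : Prop :=
  exists a : 'rV[R]_2,
    [/\ ray_from a r,
        vertex_point phi a
      & forall p, r p -> p <> a -> crease_point phi p].

Definition truncated_vertex (R : realType)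
    (phi : 'rV[R]_2 -> 'rV[R]_2) : Type :=
  ({p : 'rV[R]_2 | vertex_point phi p} +
   {r : set 'rV[R]_2 | crease_ray phi r})%type.

Definition truncated_adj (R : realType) (phi : 'rV[R]_2 -> 'rV[R]_2)
    (x y : truncated_vertex phi) : Prop :=
  match x, y with
  | inl p, inl q =>
      sval p <> sval q /\
      forall t : R, 0 < t < 1 ->
        crease_point phi ((1 - t) *: sval p + t *: sval q)
  | inl p, inr r => ray_from (sval p) (sval r)
  | inr r, inl p => ray_from (sval p) (sval r)
  | inr _, inr _ => False
  end.

Definition is_tree (T : finType) (e : rel T) : Prop :=
  [/\ symmetric e,
      irreflexive e,
      (forall x y, connect e x y)
    & forall c : seq T, ucycle e c -> (size c <= 2)%N].

Definition degree (T : finType) (e : rel T) (x : T) : nat :=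
  #|[set y | e x y]%SET|.

Definition internal (T : finType) (e : rel T) (x : T) : bool :=
  (1 < degree e x)%N.

Definition realized_by (T : finType) (e : rel T) (R : realType)
    (phi : 'rV[R]_2 -> 'rV[R]_2) : Prop :=
  exists h : T -> truncated_vertex phi,
    bijective h /\ (forall x y, e x y <-> truncated_adj (h x) (h y)).

(* Main.v *)
Require Import Defs.
From mathcomp Require Import all_boot all_order all_algebra.
From mathcomp Require Import all_classical all_reals all_analysis.
From mathcomp Require Import ring lra.

Set Implicit Arguments.
Unset Strict Implicit.
Unset Printing Implicit Defensive.

Import Order.TTheory GRing.Theory Num.Theory.
Import numFieldNormedType.Exports.

Local Open Scope classical_set_scope.
Local Open Scope ring_scope.

(* The crease pattern is grown from the single fold (x, y) |-> (x, |y|), whose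
   crease, cut at the root vertex, gives two rays of creases.  If v is the apex
   of a crease ray, or a point chosen on it, reflecting a thin wedge with apex v
   around the ray across the two sides of the wedge creates two more crease rays
   at v.  In the image this folds the wedge over the adjacent sectors, so the new
   map is still continuous and piecewise isometric.  As the degrees of internal
   nodes are even, such steps add their missing neighbours in pairs; taking
   every wedge inside a sector that contains no other crease keeps the pattern
   a plane drawing of the tree.

   For thin wedges the new isometries are close to old ones, so all of them can
   be kept with a positive x-derivative of the x-coordinate.  Then the
   x-coordinate of phi increases along every horizontal line, hence
   p |-> (phi p, y) is an embedding of the plane into space that projects exactly
   onto phi, and no perturbation is needed for global foldability. *)

(** * Coordinates in the plane *)

(** Creases and vertices are certified by collisions. An isometry is injective, so two points with
    one image in every neighbourhood of [p] exclude an unfolded point, and three exclude a crease.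
    Conversely, a finite list of explicit isometries covering the map supplies the pieces asked for
    at a vertex.

    The obstacle in growing the tree is that a folding step needs a wedge containing no crease but
    its own ray. Each edge that is still an infinite ray therefore carries a reserved open wedge,
    kept away from all other edges, all placed nodes and all other reserved wedges. Placing a node
    on a ray leaves the map alone: the node lies on a straight crease, and becomes a vertex only at
    the first folding step made there, which occurs because its degree exceeds two. Placing it also
    takes a free ray from its parent, so all neighbours of placed nodes are drawn before another
    node is placed.

    Angles are handled through their tangents, in frames that are never normalised, so wedge
    computations stay rational. *)

Section Plane.
Variable R : realType.
Local Notation P := 'rV[R]_2.
Implicit Types (p q v d : P) (f g phi : P -> P).

Definition xc p : R := p 0 0.
Definition yc p : R := p 0 1.
Definition pt (x y : R) : P := \row_(j < 2) (if j == 0 then x else y).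

Lemma xc_pt x y : xc (pt x y) = x. Proof. by rewrite /xc mxE. Qed.
Lemma yc_pt x y : yc (pt x y) = y. Proof. by rewrite /yc mxE. Qed.

Lemma ord2_cases (j : 'I_2) : j = 0 \/ j = 1.
Proof. by case: j => [[|[|j]] lt] //; [left | right]; apply/val_inj. Qed.

Lemma ptP p q : xc p = xc q -> yc p = yc q -> p = q.
Proof.
move=> hx hy; apply/rowP => j; case: (ord2_cases j) => ->; [exact: hx | exact: hy].
Qed.

Lemma xcD p q : xc (p + q) = xc p + xc q. Proof. by rewrite /xc mxE. Qed.
Lemma ycD p q : yc (p + q) = yc p + yc q. Proof. by rewrite /yc mxE. Qed.
Lemma xcN p : xc (- p) = - xc p. Proof. by rewrite /xc mxE. Qed.
Lemma ycN p : yc (- p) = - yc p. Proof. by rewrite /yc mxE. Qed.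
Lemma xcZ t p : xc (t *: p) = t * xc p. Proof. by rewrite /xc mxE. Qed.
Lemma ycZ t p : yc (t *: p) = t * yc p. Proof. by rewrite /yc mxE. Qed.
Lemma xc0 : xc 0 = 0. Proof. by rewrite /xc mxE. Qed.
Lemma yc0 : yc 0 = 0. Proof. by rewrite /yc mxE. Qed.
Definition ptE := (xc_pt, yc_pt, xcD, ycD, xcN, ycN, xcZ, ycZ, xc0, yc0).

Lemma edistE p q :
  Defs.edist p q = Num.sqrt ((xc p - xc q) ^+ 2 + (yc p - yc q) ^+ 2).
Proof.
rewrite /Defs.edist !big_ord_recl big_ord0 addr0.
by have -> : lift ord0 ord0 = 1 :> 'I_2 by apply/val_inj.
Qed.

Lemma sumsq_le0 (x y : R) : x ^+ 2 + y ^+ 2 <= 0 -> x = 0 /\ y = 0.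
Proof.
move=> h; have hx := sqr_ge0 x; have hy := sqr_ge0 y.
by split; apply/eqP; rewrite -sqrf_eq0; apply/eqP; lra.
Qed.

Lemma edist_eq0 p q : Defs.edist p q = 0 -> p = q.
Proof.
rewrite edistE => /eqP; rewrite sqrtr_eq0 => h.
by have [hx hy] := sumsq_le0 h; apply: ptP; apply/eqP; rewrite -subr_eq0; apply/eqP.
Qed.

Lemma nbhs_box p (N : set P) : nbhs p N <->
  exists2 e : R, 0 < e & forall q, `|xc p - xc q| < e -> `|yc p - yc q| < e -> N q.
Proof.
split.
- move=> /nbhs_ballP[e /= e0 H]; exists e => // q hx hy; apply: H.
  split=> // i j; rewrite (ord1 i); case: (ord2_cases j) => ->.
  + exact: hx.
  + exact: hy.
- move=> [e e0 H]; apply/nbhs_ballP; exists e => //= q [_ hq].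
  by apply: H; [exact: (hq 0 0) | exact: (hq 0 1)].
Qed.

Lemma cont_box f p : {for p, continuous f} <->
  forall e : R, 0 < e -> \forall q \near p,
    `|xc (f p) - xc (f q)| < e /\ `|yc (f p) - yc (f q)| < e.
Proof.
split.
- move=> cf e e0.
  pose N : set P := [set z | `|xc (f p) - xc z| < e /\ `|yc (f p) - yc z| < e].
  have : nbhs (f p) N by apply/nbhs_box; exists e.
  by move=> /cf.
- move=> H N /nbhs_box[e e0 He].
  suff: \forall q \near p, N (f q) by [].
  by apply: filterS (H e e0) => q [hx hy]; exact: He.
Qed.

Definition dot d p := xc d * xc p + yc d * yc p.
Definition crs d p := xc d * yc p - yc d * xc p.
Definition perp d : P := pt (- yc d) (xc d).

(** The expression is affine in the coordinates of [p]. The radius is its value at [p] divided by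
    the sum of the absolute values of its coefficients, plus one to avoid a zero denominator. Every
    open sector below is cut out by such inequalities. *)
Lemma near_dot_crs d v (a b c : R) p : 0 < a * dot d (p - v) + b * crs d (p - v) + c ->
  \forall q \near p, 0 < a * dot d (q - v) + b * crs d (q - v) + c.
Proof.
pose A := a * xc d - b * yc d; pose B := a * yc d + b * xc d.
have E q : a * dot d (q - v) + b * crs d (q - v) + c =
  A * xc q + B * yc q + (c - A * xc v - B * yc v).
  by rewrite /dot /crs /A /B !ptE; ring.
rewrite E => h.
have n0 : 0 <= `|A| + `|B| by rewrite addr_ge0.
set g := _ + _ in h; pose e := g / (`|A| + `|B| + 1).
have e0 : 0 < e by rewrite divr_gt0 // ltr_wpDl.
have ge : g = e * (`|A| + `|B| + 1) by rewrite /e divfK // gt_eqF // ltr_wpDl.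
apply/nbhs_box; exists e => // q hx hy; rewrite E.
have HA : A * (xc p - xc q) <= `|A| * e.
  by rewrite (le_trans (ler_norm _)) // normrM ler_wpM2l // ltW.
have HB : B * (yc p - yc q) <= `|B| * e.
  by rewrite (le_trans (ler_norm _)) // normrM ler_wpM2l // ltW.
by rewrite /g in ge; lra.
Qed.

Lemma dotdd_gt0 d : d != 0 -> 0 < dot d d.
Proof.
move=> d0; rewrite lt_neqAle; apply/andP; split; last first.
  by rewrite /dot -!expr2 addr_ge0 // sqr_ge0.
apply: contra d0 => /eqP h; apply/eqP.
have [|hx hy] := @sumsq_le0 (xc d) (yc d); first by rewrite !expr2 -/(dot d d) -h.
by apply: ptP; rewrite ptE.
Qed.

End Plane.

(** * Plane isometries *)

Section Rigid.
Variable R : realType.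
Local Notation P := 'rV[R]_2.
Implicit Types (p q v d w : P) (f g phi psi : P -> P).

Lemma near_segment p w (N : set P) : nbhs p N ->
  exists2 tau : R, 0 < tau & forall r, `|r| <= tau -> N (p + r *: w).
Proof.
move=> /nbhs_box[e e0 H]; pose n := `|xc w| + `|yc w| + 1.
have n0 : 0 < n by rewrite ltr_wpDl // addr_ge0.
exists (e / (2 * n)); first by rewrite divr_gt0 // mulr_gt0.
have ee : e = 2 * (e / (2 * n)) * n by field; rewrite gt_eqF.
have t0 : 0 < e / (2 * n) by rewrite divr_gt0 // mulr_gt0.
move=> r hr; set t := e / (2 * n) in ee t0 hr.
have hx : `|xc w| * `|r| <= `|xc w| * t by rewrite ler_wpM2l.
have hy : `|yc w| * `|r| <= `|yc w| * t by rewrite ler_wpM2l.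
have px : 0 <= `|xc w| * t by rewrite mulr_ge0 // ltW.
have py : 0 <= `|yc w| * t by rewrite mulr_ge0 // ltW.
by apply: H; rewrite !ptE opprD addNKr normrN normrM; rewrite /n in ee; lra.
Qed.

(** The matrix normal form: a rotation with cosine [a] and sine [b], preceded by the reflection in
    the x-axis when [s = -1], then a translation. Continuity, composition and [slope] (which equals
    [a]) can be read off it. *)
Definition rigid f := exists a b s u w : R,
  [/\ a ^+ 2 + b ^+ 2 = 1, s ^+ 2 = 1 & forall p,
      f p = pt (a * xc p - s * b * yc p + u) (b * xc p + s * a * yc p + w)].

Definition slope f := xc (f (pt 1 0)) - xc (f 0).

Definition good f := rigid f /\ 0 < slope f.

Lemma rigid_edist f : rigid f -> isometry_on setT f.
Proof.
move=> [a [b [s [u [w [ab ss E]]]]]] p q _ _.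
rewrite !edistE !E !ptE; congr Num.sqrt.
transitivity ((a ^+ 2 + b ^+ 2) * ((xc p - xc q) ^+ 2 + s ^+ 2 * (yc p - yc q) ^+ 2)).
  by ring.
by rewrite ab ss; ring.
Qed.

Lemma edist_inj f (A : set P) p q : isometry_on A f -> A p -> A q ->
  f p = f q -> p = q.
Proof.
move=> fi Ap Aq fpq; apply: edist_eq0; rewrite -fi // fpq edistE !subrr.
by rewrite expr0n addr0 sqrtr0.
Qed.

Lemma rigid_inj f : rigid f -> injective f.
Proof. by move=> /rigid_edist fi p q; exact: edist_inj fi _ _. Qed.

Lemma rigid_comp f g : rigid f -> rigid g -> rigid (f \o g).
Proof.
move=> [a [b [s [u [w [ab ss E]]]]]] [a' [b' [s' [u' [w' [ab' ss' E']]]]]].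
exists (a * a' - s * b * b'), (b * a' + s * a * b'), (s * s').
exists (a * u' - s * b * w' + u), (b * u' + s * a * w' + w); split.
- transitivity ((a ^+ 2 + b ^+ 2) * (a' ^+ 2 + s ^+ 2 * b' ^+ 2)); first by ring.
  by rewrite ab ss; lra.
- by rewrite exprMn ss ss' mulr1.
- move=> p; rewrite /= E' E !ptE.
  apply: ptP; rewrite !ptE; last first.
    have -> : s * s' * (a * a' - s * b * b') = s * s' * a * a' - s ^+ 2 * s' * b * b' by ring.
    by rewrite ss; ring.
  have -> : s * s' * (b * a' + s * a * b') = s * s' * b * a' + s ^+ 2 * s' * a * b' by ring.
  by rewrite ss; ring.
Qed.

Lemma rigid_cont f p : rigid f -> {for p, continuous f}.
Proof.
move=> [a [b [s [u [w [ab ss E]]]]]].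
have n1 (x y : R) : x ^+ 2 + y ^+ 2 = 1 -> `|x| <= 1.
  move=> h; rewrite -(@expr_le1 _ 2) // real_normK ?num_real //.
  by have := sqr_ge0 y; lra.
have ha : `|a| <= 1 by exact: n1 ab.
have hb : `|b| <= 1 by apply: (n1 b a); lra.
have hs : `|s| = 1.
  have : `|s| ^+ 2 == 1 by rewrite real_normK ?num_real // ss.
  by rewrite sqrp_eq1 // => /eqP.
apply/cont_box => e e0; apply/nbhs_box; exists (e / 2); first by rewrite divr_gt0.
move=> q hx hy.
have bd (x z : R) : `|x| <= 1 -> `|z| < e / 2 -> `|x * z| < e / 2.
  by move=> hx1 hz; rewrite normrM (le_lt_trans _ hz) // ler_piMl.
have nsb : `|s * b| <= 1 by rewrite normrM hs mul1r.
have nsa : `|s * a| <= 1 by rewrite normrM hs mul1r.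
rewrite !E !ptE; split.
- have -> : a * xc p - s * b * yc p + u - (a * xc q - s * b * yc q + u) =
    a * (xc p - xc q) - s * b * (yc p - yc q) by ring.
  have := bd _ _ ha hx; have := bd _ _ nsb hy => h1 h2.
  by rewrite (le_lt_trans (ler_normB _ _)) //; lra.
- have -> : b * xc p + s * a * yc p + w - (b * xc q + s * a * yc q + w) =
    b * (xc p - xc q) + s * a * (yc p - yc q) by ring.
  have := bd _ _ hb hx; have := bd _ _ nsa hy => h1 h2.
  by rewrite (le_lt_trans (ler_normD _ _)) //; lra.
Qed.

Lemma rigid_horizontal f p q : rigid f -> yc p = yc q ->
  xc (f q) - xc (f p) = slope f * (xc q - xc p).
Proof.
move=> [a [b [s [u [w [_ _ E]]]]]] hy; rewrite /slope !E !ptE hy; ring.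
Qed.

(** The reflection across the line through [v] with direction [d]; dividing by [dot d d] allows a
    direction of any length. *)
Definition refl v d q : P := v + (2 * dot d (q - v) / dot d d) *: d - (q - v).

Lemma rigid_refl v d : d != 0 -> rigid (refl v d).
Proof.
move=> /dotdd_gt0 D0; have Dn : dot d d != 0 by rewrite gt_eqF.
pose a := (xc d ^+ 2 - yc d ^+ 2) / dot d d; pose b := 2 * xc d * yc d / dot d d.
have Dn' : xc d * xc d + yc d * yc d != 0 by [].
exists a, b, (-1), (2 * xc v - 2 * dot d v / dot d d * xc d),
  (2 * yc v - 2 * dot d v / dot d d * yc d); split.
- by rewrite /a /b /dot; field.
- by rewrite sqrrN expr1n.
- by move=> p; apply: ptP; rewrite /refl !ptE /a /b /dot !ptE; field.
Qed.

Lemma dot_refl v d q : d != 0 -> dot d (refl v d q - v) = dot d (q - v).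
Proof.
move=> /dotdd_gt0 D0; have Dn : xc d * xc d + yc d * yc d != 0 by rewrite gt_eqF.
by rewrite /refl /dot !ptE; field.
Qed.

Lemma crs_refl v d q : d != 0 -> crs d (refl v d q - v) = - crs d (q - v).
Proof.
move=> /dotdd_gt0 D0; have Dn : xc d * xc d + yc d * yc d != 0 by rewrite gt_eqF.
by rewrite /refl /dot /crs !ptE; field.
Qed.

(* The orthogonal decomposition [dot d d * u = dot d u * d + crs d u * perp d]. *)
Lemma dot_crs_inj d p q : d != 0 -> dot d p = dot d q -> crs d p = crs d q -> p = q.
Proof.
move=> /dotdd_gt0 D0 hd hc.
have Dn : xc d * xc d + yc d * yc d != 0 by rewrite gt_eqF.
apply: ptP; apply: (mulfI Dn).
- have -> : (xc d * xc d + yc d * yc d) * xc p = xc d * dot d p - yc d * crs d p.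
    by rewrite /dot /crs; ring.
  by rewrite hd hc /dot /crs; ring.
- have -> : (xc d * xc d + yc d * yc d) * yc p = yc d * dot d p + xc d * crs d p.
    by rewrite /dot /crs; ring.
  by rewrite hd hc /dot /crs; ring.
Qed.

Lemma refl_fixed v d q : d != 0 -> crs d (q - v) = 0 -> refl v d q = q.
Proof.
move=> d0 h; apply: (addIr (- v)); apply: (dot_crs_inj d0); first exact: dot_refl.
by rewrite crs_refl // h oppr0.
Qed.

Lemma reflK v d : d != 0 -> involutive (refl v d).
Proof.
move=> d0 q; apply: (addIr (- v)); apply: (dot_crs_inj d0); first by rewrite !dot_refl.
by rewrite !crs_refl // opprK.
Qed.

End Rigid.

(** * Local models of foldings *)

Section Local.
Variable R : realType.
Local Notation P := 'rV[R]_2.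
Implicit Types (p q v d w : P) (f g phi psi : P -> P).

(** Multiplied by [dot z z], the slope of [f \o refl v z] is a quadratic form [num] in [z]. At
    [d + s *: perp d] it equals [(1 - s ^+ 2) * N + 2 * s * B], which stays positive for small
    [s]. *)
Lemma slope_refl_near f v d : d != 0 -> rigid f -> 0 < slope (f \o refl v d) ->
  exists2 s0 : R, 0 < s0 & forall s, `|s| <= s0 ->
    0 < slope (f \o refl v (d + s *: perp d)).
Proof.
move=> d0 [a [b [c [u [w [_ _ E]]]]]].
pose num x y := a * (x ^+ 2 - y ^+ 2) - c * b * (2 * x * y).
have D0 := dotdd_gt0 d0.
have slE z : 0 < dot z z -> dot z z * slope (f \o refl v z) = num (xc z) (yc z).
  move=> z0; have zn : xc z * xc z + yc z * yc z != 0 by rewrite gt_eqF.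
  by rewrite /slope /= !E /refl /dot !ptE /num; field.
rewrite -(pmulr_rgt0 _ D0) slE //; set N := num _ _ => N0.
pose B := - 2 * a * xc d * yc d - c * b * (xc d ^+ 2 - yc d ^+ 2).
have B1 : 0 < `|B| + 1 by rewrite ltr_wpDl.
(* With this bound [2 * s * B] exceeds [- N / 2], while [|s| <= 1 / 2] keeps [(1 - s ^+ 2) * N] at
   least [3 / 4 * N]. *)
pose t := N / (4 * (`|B| + 1)).
have t0 : 0 < t by rewrite divr_gt0 // mulr_gt0.
have Nt : N = 4 * (`|B| + 1) * t by rewrite /t; field; rewrite gt_eqF.
exists (Num.min (1 / 2) t); first by rewrite lt_min t0 andbT; lra.
move=> s; rewrite le_min => /andP[s1 s2].
have ww : dot (d + s *: perp d) (d + s *: perp d) = (1 + s ^+ 2) * dot d d.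
  by rewrite /dot !ptE; ring.
have w0 : 0 < dot (d + s *: perp d) (d + s *: perp d).
  by rewrite ww mulr_gt0 // ltr_pwDl // sqr_ge0.
rewrite -(pmulr_rgt0 _ w0) slE //.
have -> : num (xc (d + s *: perp d)) (yc (d + s *: perp d)) =
    (1 - s ^+ 2) * N + 2 * s * B.
  by rewrite /N /num /B !ptE; ring.
have ss : s ^+ 2 <= 1 / 4.
  by rewrite -real_normK ?num_real //; have := normr_ge0 s; nra.
have sB : - (t * `|B|) <= s * B.
  rewrite lerNl -mulNr; apply: (le_trans (ler_norm _)).
  by rewrite normrM normrN ler_wpM2r.
have sN : s ^+ 2 * N <= 1 / 4 * N by rewrite ler_wpM2r // ltW.
by have := normr_ge0 B; nra.
Qed.

Definition flat phi p := exists2 f, rigid f & \forall q \near p, phi q = f q.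

Definition two_sheeted phi p := exists f g, [/\ rigid f, rigid g,
  f p = phi p, g p = phi p & \forall q \near p, phi q = f q \/ phi q = g q].

(** The two sheets may coincide in [two_sheeted]; it is the collision of two points in every
    neighbourhood that forces them apart and prevents [p] from being unfolded. [vertexy] asks for
    triple collisions in the same spirit. *)
Definition creasy phi p := two_sheeted phi p /\
  forall N : set P, nbhs p N -> exists q r, [/\ N q, N r, q <> r & phi q = phi r].

Definition vertexy phi p := forall N : set P, nbhs p N -> exists q r t,
  [/\ N q, N r, N t, [/\ q <> r, q <> t & r <> t] & phi q = phi r /\ phi q = phi t].

Lemma near_flat phi psi p : (\forall q \near p, psi q = phi q) ->
  flat phi p -> flat psi p.
Proof.
move=> h [f rf hf]; exists f => //.
by near=> q; rewrite (near h q) //; near: q.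
Unshelve. all: by end_near. Qed.

Lemma near_creasy phi psi p : (\forall q \near p, psi q = phi q) ->
  creasy phi p -> creasy psi p.
Proof.
move=> h [[f [g [rf rg fp gp hfg]]] hN].
split.
  exists f, g; rewrite (nbhs_singleton h); split=> //.
  by near=> q; rewrite (near h q) //; near: q.
move=> N Np; have [q [r [[Nq hq] [Nr hr] qr E]]] := hN _ (filterI Np h).
by exists q, r; rewrite hq hr.
Unshelve. all: by end_near. Qed.

Lemma near_vertexy phi psi p : (\forall q \near p, psi q = phi q) ->
  vertexy phi p -> vertexy psi p.
Proof.
move=> h hN N Np; have [q [r [t [[Nq hq] [Nr hr] [Nt ht] qrt E]]]] := hN _ (filterI Np h).
by exists q, r, t; rewrite hq hr ht.
Qed.

Lemma flat_two_sheeted phi p : flat phi p -> two_sheeted phi p.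
Proof.
move=> [f rf h]; exists f, f; rewrite (nbhs_singleton h); split=> //.
by apply: filterS h => q ->; left.
Qed.

Lemma two_sheeted_cont phi p : two_sheeted phi p -> {for p, continuous phi}.
Proof.
move=> [f [g [rf rg fp gp h]]]; apply/cont_box => e e0.
have /cont_box/(_ e e0) cf := rigid_cont (p := p) rf.
have /cont_box/(_ e e0) cg := rigid_cont (p := p) rg.
rewrite fp in cf; rewrite gp in cg.
near=> q.
have [->|->] : phi q = f q \/ phi q = g q by near: q.
- by near: q.
- by near: q.
Unshelve. all: by end_near. Qed.

Definition cone v d (k : R) : set P :=
  [set q | `|crs d (q - v)| < k * dot d (q - v)].

(** The model of a single straight crease: fold the plane onto the left side of the line through [v]
    along [d], then apply [f]. *)
Definition fold_on (A : set P) v d f phi := forall q, A q ->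
  phi q = if 0 <= crs d (q - v) then f q else f (refl v d q).

Lemma near_cone v d k p : cone v d k p -> \forall q \near p, cone v d k q.
Proof.
rewrite /cone /= ltr_norml => /andP[h1 h2].
have n1 : \forall q \near p, 0 < k * dot d (q - v) + 1 * crs d (q - v) + 0.
  by apply: near_dot_crs; lra.
have n2 : \forall q \near p, 0 < k * dot d (q - v) + (-1) * crs d (q - v) + 0.
  by apply: near_dot_crs; lra.
near=> q.
have h3 : 0 < k * dot d (q - v) + 1 * crs d (q - v) + 0 by near: q.
have h4 : 0 < k * dot d (q - v) + (-1) * crs d (q - v) + 0 by near: q.
by rewrite /cone /= ltr_norml; apply/andP; split; lra.
Unshelve. all: by end_near. Qed.

Lemma near_crs_gt0 v d p : 0 < crs d (p - v) -> \forall q \near p, 0 < crs d (q - v).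
Proof.
move=> h; have := @near_dot_crs _ d v 0 1 0 p.
rewrite mul0r add0r mul1r addr0 => /(_ h); apply: filterS => q.
by rewrite mul0r add0r mul1r addr0.
Qed.

Lemma near_crs_lt0 v d p : crs d (p - v) < 0 -> \forall q \near p, crs d (q - v) < 0.
Proof.
move=> h; have := @near_dot_crs _ d v 0 (-1) 0 p.
rewrite mul0r add0r mulN1r addr0 oppr_gt0 => /(_ h); apply: filterS => q.
by rewrite mul0r add0r mulN1r addr0 oppr_gt0.
Qed.


Lemma fold_on_flat A v d f phi p : d != 0 -> rigid f -> fold_on A v d f phi ->
  nbhs p A -> crs d (p - v) != 0 -> flat phi p.
Proof.
move=> d0 rf hf Ap; case: ltgtP => // hp _.
- exists (f \o refl v d); first by apply: rigid_comp => //; exact: rigid_refl.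
  have n1 := near_crs_lt0 hp.
  near=> q; rewrite hf; last by near: q.
  by rewrite leNgt (near n1 q).
- exists f => //; have n1 := near_crs_gt0 hp.
  near=> q; rewrite hf; last by near: q.
  by rewrite ltW // (near n1 q).
Unshelve. all: by end_near. Qed.

Lemma fold_on_creasy A v d f phi p : d != 0 -> rigid f -> fold_on A v d f phi ->
  nbhs p A -> crs d (p - v) = 0 -> creasy phi p.
Proof.
move=> d0 rf hf Ap hp.
have fp : f p = phi p by rewrite (hf _ (nbhs_singleton Ap)) hp lexx.
split.
  exists f, (f \o refl v d); split=> //=.
  - by apply: rigid_comp => //; exact: rigid_refl.
  - by rewrite refl_fixed.
  - by apply: filterS Ap => q /hf ->; case: ifP; [left | right].
(* The colliding points are [p] shifted by [t] to either side of the crease; being mirror images,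
   they are folded together. *)
move=> N Np; have [t t0 ht] := near_segment (perp d) (filterI Np Ap).
have [Nq Aq] : N (p + t *: perp d) /\ A (p + t *: perp d).
  by apply: ht; rewrite ger0_norm // ltW.
have [Nr Ar] : N (p + (- t) *: perp d) /\ A (p + (- t) *: perp d).
  by apply: ht; rewrite normrN ger0_norm // ltW.
have D0 := dotdd_gt0 d0.
have cq r : crs d (p + r *: perp d - v) = r * dot d d.
  transitivity (crs d (p - v) + r * dot d d); last by rewrite hp add0r.
  by rewrite /crs /dot !ptE; ring.
have dq r : dot d (p + r *: perp d - v) = dot d (p - v).
  by rewrite /crs /dot !ptE; ring.
exists (p + t *: perp d), (p + (- t) *: perp d); split => //.
- move=> /(congr1 (fun q => crs d (q - v))); rewrite !cq => /eqP.
  by rewrite -subr_eq0 -mulrBl opprK mulf_eq0 !gt_eqF // addr_gt0.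
- rewrite !hf // !cq pmulr_lge0 // ltW // pmulr_lge0 // oppr_ge0 leNgt t0 /=.
  congr f; apply: (addIr (- v)); apply: (dot_crs_inj d0).
  + by rewrite dot_refl // !dq.
  + by rewrite crs_refl // !cq mulNr opprK.
Qed.

End Local.

(** * Adding a pair of crease rays *)

Section Pair.
Variable R : realType.
Local Notation P := 'rV[R]_2.
Implicit Types (p q v d w : P) (f g phi psi : P -> P).

Definition ray v d : set P := [set q | crs d (q - v) = 0 /\ 0 <= dot d (q - v)].

(** The licence for a folding step: inside the cone the ray is the only crease, and the isometries
    on both of its sides are good. The value at [v] is a separate condition because the open cone
    misses its apex. *)
Definition clean phi v d k := exists f, [/\ good f, good (f \o refl v d),
  f v = phi v & fold_on (cone v d k) v d f phi].

(** The direction [d] turned by the angle with tangent [s], with its length multiplied by the square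
    root of [1 + s ^+ 2]. *)
Definition tilt d (s : R) : P := d + s *: perp d.

Lemma crs_tilt d s u : crs (tilt d s) u = crs d u - s * dot d u.
Proof. by rewrite /crs /dot !ptE; ring. Qed.

Lemma dot_tilt d s u : dot (tilt d s) u = dot d u + s * crs d u.
Proof. by rewrite /crs /dot !ptE; ring. Qed.

Lemma dot_tilt2 d s : dot (tilt d s) (tilt d s) = (1 + s ^+ 2) * dot d d.
Proof. by rewrite /dot !ptE; ring. Qed.

Lemma tilt_neq0 d s : d != 0 -> tilt d s != 0.
Proof.
move=> /dotdd_gt0 D0; apply/eqP => h; have := dot_tilt2 d s.
rewrite h /dot !ptE !mul0r addr0 => /esym/eqP.
by rewrite mulf_eq0 !gt_eqF // ltr_pwDl // sqr_ge0.
Qed.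

(** In the frame of [d], a reflection across an axis at angle [a] has matrix entries [cos 2a] and
    [sin 2a]. With [s = tan a] these are [(1 - s ^+ 2) / (1 + s ^+ 2)] and
    [2 * s / (1 + s ^+ 2)]. *)
Lemma dot_refl_tilt v d s q : d != 0 ->
  (1 + s ^+ 2) * dot d (refl v (tilt d s) q - v) =
  (1 - s ^+ 2) * dot d (q - v) + 2 * s * crs d (q - v).
Proof.
move=> d0; have D0 := dotdd_gt0 d0; have s1 : 0 < 1 + s ^+ 2 by rewrite ltr_pwDl // sqr_ge0.
rewrite /refl dot_tilt2 dot_tilt.
have -> : dot d (v + (2 * (dot d (q - v) + s * crs d (q - v)) / ((1 + s ^+ 2) * dot d d)) *:
   tilt d s - (q - v) - v) =
   2 * (dot d (q - v) + s * crs d (q - v)) / ((1 + s ^+ 2) * dot d d) * dot d d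
     - dot d (q - v).
  by move: (_ / _) => x; rewrite /dot !ptE; ring.
by field; rewrite !gt_eqF.
Qed.

Lemma crs_refl_tilt v d s q : d != 0 ->
  (1 + s ^+ 2) * crs d (refl v (tilt d s) q - v) =
  2 * s * dot d (q - v) - (1 - s ^+ 2) * crs d (q - v).
Proof.
move=> d0; have D0 := dotdd_gt0 d0; have s1 : 0 < 1 + s ^+ 2 by rewrite ltr_pwDl // sqr_ge0.
rewrite /refl dot_tilt2 dot_tilt.
have -> : crs d (v + (2 * (dot d (q - v) + s * crs d (q - v)) / ((1 + s ^+ 2) * dot d d)) *:
   tilt d s - (q - v) - v) =
   2 * (dot d (q - v) + s * crs d (q - v)) / ((1 + s ^+ 2) * dot d d) * (s * dot d d)
     - crs d (q - v).
  by move: (_ / _) => x; rewrite /dot /crs !ptE; ring.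
by field; rewrite !gt_eqF.
Qed.

(** [refl v d] exchanges the lines along [tilt d s] and [tilt d (- s)], hence conjugates one
    reflection into the other. This is the closing condition around [v]: it makes the two reflected
    half-wedges agree along the central ray. *)
Lemma refl_tilt_conj v d s q : d != 0 ->
  refl v d (refl v (tilt d (- s)) q) = refl v (tilt d s) (refl v d q).
Proof.
move=> d0; have s1 : 1 + s ^+ 2 != 0 by rewrite gt_eqF // ltr_pwDl // sqr_ge0.
apply: (addIr (- v)); apply: (dot_crs_inj d0); apply: (mulfI s1).
- have hd := dot_refl_tilt v (- s) q d0; rewrite sqrrN in hd.
  rewrite (dot_refl v _ d0) hd dot_refl_tilt // (dot_refl v q d0) (crs_refl v q d0).
  by ring.
- have hc := crs_refl_tilt v (- s) q d0; rewrite sqrrN in hc.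
  rewrite (crs_refl v _ d0) mulrN hc crs_refl_tilt // (dot_refl v q d0) (crs_refl v q d0).
  by ring.
Qed.

Lemma refl_center v d : refl v d v = v.
Proof. by apply: ptP; rewrite /refl subrr /dot !ptE; ring. Qed.

Lemma cone_dot_gt0 v d k q : 0 < k -> cone v d k q -> 0 < dot d (q - v).
Proof.
move=> k0 h; rewrite -(pmulr_rgt0 _ k0); exact: le_lt_trans (normr_ge0 _) h.
Qed.

Lemma near_sector v d (a b : R) p : 0 < a * dot d (p - v) + b * crs d (p - v) ->
  \forall q \near p, 0 < a * dot d (q - v) + b * crs d (q - v).
Proof.
move=> h; have := @near_dot_crs _ d v a b 0 p; rewrite addr0 => /(_ h).
by apply: filterS => q; rewrite addr0.
Qed.

Lemma ray_cone v d k p : d != 0 -> 0 < k -> ray v d p -> p <> v -> cone v d k p.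
Proof.
move=> d0 k0 [hp tp] pv; rewrite /cone /= hp normr0 mulr_gt0 //.
rewrite lt_neqAle tp andbT eq_sym; apply/eqP => t0.
apply: pv; apply: (addIr (- v)); apply: (dot_crs_inj d0).
- by rewrite t0 subrr /dot !ptE; ring.
- by rewrite hp subrr /crs !ptE; ring.
Qed.

Lemma clean_creasy phi v d k p : d != 0 -> 0 < k -> clean phi v d k ->
  ray v d p -> p <> v -> creasy phi p.
Proof.
move=> d0 k0 [f [[rf _] _ _ hf]] rp pv; have cp := ray_cone d0 k0 rp pv.
by apply: (fold_on_creasy d0 rf hf) (rp.1); exact: near_cone.
Qed.

(** * Slope inequalities for sectors, with [t] and [h] standing for [dot] and [crs] *)

Section Sectors.
Variables s k t h : R.

Lemma sector_pos : 0 < s -> 8 * s <= k -> s * t <= h -> h < k * t -> 0 < t.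
Proof. by move=> *; nra. Qed.

(** The cone around the tilted ray has slopes strictly between [s / 2] and [2 * s]. Hence it misses
    the central cone, of slopes below [s / 4] in absolute value, and the mirror cone, and fits into
    the old cone because [8 * s <= k]. *)
Lemma tilted_sector : 0 < s -> s <= 1 / 4 ->
  `|h - s * t| < s / 4 * (t + s * h) -> [/\ 0 < t, s / 2 * t < h & h < 2 * s * t].
Proof.
rewrite ltr_norml => s0 s1 /andP[h1 h2].
have s2 : s * s <= 1 / 16 by nra.
have ss0 : 0 <= s * s by rewrite mulr_ge0 // ltW.
have t0 : 0 < t.
  rewrite ltNge; apply/negP => tn.
  have st : s * t <= 0 by rewrite mulr_ge0_le0 // ltW.
  have [hn|hn] := lerP 0 h.
    have ssh : s * s * h <= 1 / 16 * h by rewrite ler_wpM2r.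
    by lra.
  have ssh : s * s * h <= 0 by rewrite mulr_ge0_le0 // ltW.
  by lra.
have st : 0 < s * t by exact: mulr_gt0.
have h0 : 0 < h.
  rewrite ltNge; apply/negP => hn.
  have ssh : s * s * h <= 0 by rewrite mulr_ge0_le0.
  by lra.
have ssh : s * s * h <= 1 / 16 * h by rewrite ler_wpM2r // ltW.
have ssh0 : 0 <= s * s * h by rewrite mulr_ge0 // ltW.
by split=> //; lra.
Qed.

Lemma sector_triple : 0 < s -> s <= 1 / 4 -> 8 * s <= k ->
  [/\ s / 2 <= s * (1 + s / 2 * s), s * (1 - s / 2 * s) <= s + s / 2
    & s + s / 2 < k * (1 - s / 2 * s)].
Proof.
move=> s0 s1 sk; have ss0 : 0 <= s * s by rewrite mulr_ge0 // ltW.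
have sss0 : 0 <= s * (s * s) by rewrite mulr_ge0 // ltW.
have ss1 : s * s <= 1 / 4 * (1 / 4) by rewrite ler_pM // ltW.
have k0 : 0 < k by lra.
have ks : k * (s * s) <= k * (1 / 16) by rewrite ler_pM2l //; lra.
by split; lra.
Qed.

Lemma sector_neq : 0 < s ->
  [/\ s / 2 != s + s / 2, s / 2 != - (s / 2) & s + s / 2 != - (s / 2)].
Proof. by move=> s0; split; apply/eqP => E; lra. Qed.

Lemma sector_scale : 0 < s -> 8 * s <= k -> 0 < t -> 0 < s * t /\ 8 * (s * t) <= k * t.
Proof. by move=> *; split; nra. Qed.

End Sectors.

(** * One folding step: the wedge of slope [s] around a clean ray is reflected *)

Section FoldPair.
Variables (phi : P -> P) (v d : P) (k : R) (f : P -> P) (s : R).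
Hypotheses (d0 : d != 0) (k0 : 0 < k) (s0 : 0 < s) (s1 : s <= 1 / 4) (sk : 8 * s <= k).
Hypotheses (phic : continuous phi) (gf : good f) (gfd : good (f \o refl v d)).
Hypotheses (fv : f v = phi v) (fold : fold_on (cone v d k) v d f phi).
Hypotheses (gup : good (f \o refl v (tilt d s))).
Hypotheses (gdn : good (f \o refl v d \o refl v (tilt d (- s)))).

Let up := tilt d s.
Let dn := tilt d (- s).
Let t q := dot d (q - v).
Let h q := crs d (q - v).

(* On the right of the ray, where [h q <= 0], [phi] is [f \o refl v d]. *)
Definition fold_pair q : P :=
  if `|h q| <= s * t q then
    if 0 <= h q then f (refl v up q) else f (refl v d (refl v dn q))
  else phi q.

Local Notation psi := fold_pair.

Let up0 : up != 0. Proof. exact: tilt_neq0. Qed.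
Let dn0 : dn != 0. Proof. exact: tilt_neq0. Qed.

Let scale q : 0 < t q -> 0 < s * t q /\ 8 * (s * t q) <= k * t q.
Proof. exact: sector_scale. Qed.

Let coneP q : reflect (- (k * t q) < h q /\ h q < k * t q) (`|h q| < k * t q).
Proof. by rewrite ltr_norml; exact: andP. Qed.

Lemma fold_pair_out q : ~~ (`|h q| <= s * t q) -> psi q = phi q.
Proof. by rewrite /fold_pair => /negbTE ->. Qed.

Lemma fold_pair_up q : 0 <= h q -> h q <= s * t q -> psi q = f (refl v up q).
Proof. by move=> h1 h2; rewrite /fold_pair ger0_norm // h2 h1. Qed.

Lemma fold_pair_dn q : h q <= 0 -> - (s * t q) <= h q -> psi q = f (refl v d (refl v dn q)).
Proof.
move=> h1 h2; rewrite /fold_pair ler0_norm // lerNl h2.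
(* Only the ray itself is at issue: the definition uses the upper formula there, and the conjugation
   identity identifies it with the lower one. *)
case: ifP => // h3; rewrite refl_tilt_conj // (refl_fixed d0) //.
by apply/eqP; rewrite eq_le h1 h3.
Qed.

(** The border [h q = s * t q] is included: there the reflected formula applies, but [refl v up]
    fixes the point. [t q] is positive because [s] is smaller than [k]. *)
Lemma fold_pair_top q : s * t q <= h q -> h q < k * t q -> psi q = f q.
Proof.
move=> h1 h2; have t0 : 0 < t q by exact: sector_pos h1 h2.
have [st kt] := scale t0; have [h3|h3] := eqVneq (h q) (s * t q).
  rewrite fold_pair_up ?h3 //; last exact: ltW.
  by rewrite refl_fixed // crs_tilt -/(h q) -/(t q) h3 subrr.
have h4 : 0 < h q by exact: lt_le_trans h1.
rewrite fold_pair_out; last by rewrite (ger0_norm (ltW h4)) -ltNge lt_neqAle eq_sym h3.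
rewrite fold; first by rewrite ltW.
by apply/coneP; split; lra.
Qed.

Lemma fold_pair_bot q : h q <= - (s * t q) -> - (k * t q) < h q -> psi q = f (refl v d q).
Proof.
move=> h1 h2.
have t0 : 0 < t q by apply: (@sector_pos s k _ (- h q)) => //; lra.
have [st kt] := scale t0; have [h3|h3] := eqVneq (h q) (- (s * t q)).
  rewrite fold_pair_dn ?h3 //; last by lra.
  by congr (f (refl _ _ _)); rewrite refl_fixed // crs_tilt -/(h q) -/(t q) h3; ring.
have h4 : h q < 0 by lra.
rewrite fold_pair_out; last by rewrite (ler0_norm (ltW h4)) -ltNge ltrNr lt_neqAle h3.
rewrite fold; first by rewrite leNgt h4.
by apply/coneP; split; lra.
Qed.

Lemma fold_pair_notin_cone q : ~ cone v d k q -> q <> v -> ~~ (`|h q| <= s * t q).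
Proof.
move=> nq qv; apply/negP => hq; apply: nq; rewrite /cone /= -/(h q) -/(t q).
have h0 := normr_ge0 (h q).
have t0 : t q != 0.
  apply/eqP => tq; apply: qv; apply: (addIr (- v)); apply: (dot_crs_inj d0).
    by rewrite -/(t q) tq subrr /dot !ptE; ring.
  move: hq; rewrite tq mulr0 normr_le0 => /eqP hq.
  by rewrite -/(h q) hq subrr /crs !ptE; ring.
have t1 : 0 < t q.
  by rewrite lt_neqAle eq_sym t0 /= -(pmulr_rge0 _ s0); exact: le_trans hq.
by have [st kt] := scale t1; lra.
Qed.

Lemma fold_pair_apex : psi v = phi v.
Proof.
rewrite fold_pair_up ?refl_center //; rewrite /h /t subrr /crs /dot !ptE; lra.
Qed.

(** The closed wedge that is changed lies in the open cone except for the apex, where all formulas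
    give [phi v]. *)
Lemma fold_pair_id q : ~ cone v d k q -> psi q = phi q.
Proof.
move=> nq; have [->|qv] := eqVneq q v; first exact: fold_pair_apex.
by rewrite fold_pair_out // fold_pair_notin_cone //; exact/eqP.
Qed.

Lemma fold_pair_near_out p : ~~ (`|h p| <= s * t p) -> \forall q \near p, psi q = phi q.
Proof.
rewrite -ltNge => hp.
have [|] : 0 < (- s) * t p + 1 * h p \/ 0 < (- s) * t p + (-1) * h p.
- by move: hp; case: (ger0P (h p)) => h1 h2; [left | right]; lra.
- move=> /near_sector; apply: filterS => q hq; apply: fold_pair_out.
  by rewrite -ltNge; apply: lt_le_trans (ler_norm _); rewrite /h /t; lra.
- move=> /near_sector; apply: filterS => q hq; apply: fold_pair_out.
  rewrite -ltNge; apply: lt_le_trans (_ : - h q <= _); first by rewrite /h /t; lra.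
  by rewrite -normrN ler_norm.
Qed.

Lemma fold_pair_near p : p <> v -> ~ cone v d k p -> \forall q \near p, psi q = phi q.
Proof. by move=> pv np; apply: fold_pair_near_out; exact: fold_pair_notin_cone. Qed.

Let cone_up q : cone v up (s / 4) q ->
  [/\ 0 < t q, s / 2 * t q < h q & h q < 2 * s * t q].
Proof. by rewrite /cone /= crs_tilt dot_tilt; exact: tilted_sector. Qed.

Let cone_dn q : cone v dn (s / 4) q ->
  [/\ 0 < t q, s / 2 * t q < - h q & - h q < 2 * s * t q].
Proof.
rewrite /cone /= crs_tilt dot_tilt -/(t q) -/(h q) => hq.
apply: tilted_sector => //.
have -> : - h q - s * t q = - (h q - - s * t q) by ring.
by rewrite normrN mulrN -mulNr.
Qed.

Let cone_mid q : cone v d (s / 4) q ->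
  [/\ 0 < t q, - (s / 4 * t q) < h q & h q < s / 4 * t q].
Proof.
move=> hq; have t0 : 0 < t q by apply: cone_dot_gt0 hq; rewrite divr_gt0.
by move: hq; rewrite /cone /= -/(t q) -/(h q) ltr_norml => /andP[h1 h2].
Qed.

Lemma cone_up_sub : cone v up (s / 4) `<=` cone v d k.
Proof. by move=> q /cone_up[t0 h1 h2]; have [st kt] := scale t0; apply/coneP; split; lra. Qed.

Lemma cone_dn_sub : cone v dn (s / 4) `<=` cone v d k.
Proof. by move=> q /cone_dn[t0 h1 h2]; have [st kt] := scale t0; apply/coneP; split; lra. Qed.

Lemma cone_mid_sub : cone v d (s / 4) `<=` cone v d k.
Proof. by move=> q /cone_mid[t0 h1 h2]; have [st kt] := scale t0; apply/coneP; split; lra. Qed.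

Lemma cone_up_dn q : cone v up (s / 4) q -> ~ cone v dn (s / 4) q.
Proof. by move=> /cone_up[t0 h1 h2] /cone_dn[t0' h1' h2']; have [st kt] := scale t0; lra. Qed.

Lemma cone_up_mid q : cone v up (s / 4) q -> ~ cone v d (s / 4) q.
Proof. by move=> /cone_up[t0 h1 h2] /cone_mid[t0' h1' h2']; have [st kt] := scale t0; lra. Qed.

Lemma cone_dn_mid q : cone v dn (s / 4) q -> ~ cone v d (s / 4) q.
Proof. by move=> /cone_dn[t0 h1 h2] /cone_mid[t0' h1' h2']; have [st kt] := scale t0; lra. Qed.

Lemma clean_up : clean psi v up (s / 4).
Proof.
exists f; split=> //; first by rewrite fv fold_pair_apex.
move=> q /cone_up[t1 h1 h2]; have [st kt] := scale t1; rewrite crs_tilt -/(t q) -/(h q).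
by case: ifP => h3; [apply: fold_pair_top | apply: fold_pair_up]; lra.
Qed.

Lemma clean_dn : clean psi v dn (s / 4).
Proof.
exists (f \o refl v d \o refl v dn); split=> //.
- by rewrite (_ : _ \o _ = f \o refl v d) //; apply/funext => q /=; rewrite reflK.
- by rewrite /= !refl_center fv fold_pair_apex.
move=> q /cone_dn[t1 h1 h2]; have [st kt] := scale t1; rewrite crs_tilt -/(t q) -/(h q) /= reflK //.
by case: ifP => h3; [apply: fold_pair_dn | apply: fold_pair_bot]; lra.
Qed.

(** Left of the central ray the new map is [f \o refl v up]. By conjugation its right side is this
    same map after [refl v d], so the ray is again a simple crease between good isometries and can
    be folded around once more. *)
Lemma clean_mid : clean psi v d (s / 4).
Proof.
have conj q : f (refl v up (refl v d q)) = f (refl v d (refl v dn q)).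
  exact: (congr1 f (esym (refl_tilt_conj v s q d0))).
have gdn' : good ((f \o refl v up) \o refl v d).
  have -> // : (f \o refl v up) \o refl v d = f \o refl v d \o refl v dn.
  by apply/funext => q; exact: conj.
exists (f \o refl v up); split=> //.
- by rewrite /= !refl_center fv fold_pair_apex.
move=> q /cone_mid[t1 h1 h2]; have [st kt] := scale t1; rewrite -/(h q) /=.
rewrite conj.
by case: ifP => h3; [apply: fold_pair_up | apply: fold_pair_dn]; lra.
Qed.

Lemma fold_pair_flat p : cone v d k p -> ~ ray v d p -> ~ ray v up p -> ~ ray v dn p ->
  flat psi p.
Proof.
move=> cp nd nup ndn; have t0 := cone_dot_gt0 k0 cp; rewrite -/(t p) in t0.
have [st kt] := scale t0.
have sst : 0 < s * (s * t p) by exact: mulr_gt0.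
have rf : rigid f by case: gf.
have rfd : rigid (f \o refl v d) by case: gfd.
have hp0 : h p != 0 by apply/eqP => hp; apply: nd; split => //; exact: ltW.
have hpu : h p != s * t p.
  apply/eqP => hp; apply: nup; split; first by rewrite crs_tilt -/(h p) -/(t p) hp subrr.
  by rewrite dot_tilt -/(h p) -/(t p) hp; lra.
have hpd : h p != - (s * t p).
  apply/eqP => hp; apply: ndn; split; first by rewrite crs_tilt -/(h p) -/(t p) hp; ring.
  by rewrite dot_tilt -/(h p) -/(t p) hp; lra.
have [hp|hp] := boolP (`|h p| <= s * t p); last first.
  apply: (near_flat (fold_pair_near_out hp)).
  by apply: (fold_on_flat d0 rf fold) => //; apply: near_cone.
move: hp; rewrite ler_norml => /andP[h1 h2].
have h3 : 0 < s * t p + (-1) * h p by rewrite mulN1r subr_gt0 lt_neqAle hpu.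
have h4 : 0 < s * t p + 1 * h p by rewrite mul1r -ltrBlDl sub0r lt_neqAle eq_sym hpd.
have n3 := near_sector h3; have n4 := near_sector h4.
case: (ltgtP (h p) 0) hp0 => // hp _.
- exists (f \o refl v d \o refl v dn); first by apply: rigid_comp => //; exact: rigid_refl.
  have n5 := near_crs_lt0 hp.
  near=> q; apply: fold_pair_dn.
  + by apply: ltW; near: q.
  + have : 0 < s * t q + 1 * h q by near: q.
    by lra.
- exists (f \o refl v up); first by apply: rigid_comp => //; exact: rigid_refl.
  have n5 := near_crs_gt0 hp.
  near=> q; apply: fold_pair_up.
  + by apply: ltW; near: q.
  + have : 0 < s * t q + (-1) * h q by near: q.
    by lra.
Unshelve. all: by end_near. Qed.


Lemma fold_pair_cases q : [\/ psi q = phi q, psi q = (f \o refl v up) q |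
  psi q = (f \o refl v d \o refl v dn) q].
Proof.
rewrite /fold_pair; case: ifP => _; last by constructor 1.
by case: ifP => _; [constructor 2 | constructor 3].
Qed.

Let s40 : 0 < s / 4. Proof. by rewrite divr_gt0. Qed.

Lemma fold_pair_cont : continuous psi.
Proof.
move=> p; have [->|/eqP pv] := eqVneq p v.
  (* At the apex three continuous maps cover [psi], namely [phi] and the two reflected isometries,
     and all have the value [phi v] at [v]. *)
  apply/cont_box => e e0.
  have rf : rigid f by case: gf.
  have rup : rigid (f \o refl v up) by case: gup.
  have rdn : rigid (f \o refl v d \o refl v dn) by case: gdn.
  have /cont_box/(_ e e0) c1 := phic (x := v).
  have /cont_box/(_ e e0) c2 := rigid_cont (p := v) rup.
  have /cont_box/(_ e e0) c3 := rigid_cont (p := v) rdn.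
  rewrite /= !refl_center in c2 c3.
  near=> q; rewrite fold_pair_apex; have [->|->|->] := fold_pair_cases q.
  - by near: q.
  - by rewrite -fv; near: q.
  - by rewrite -fv; near: q.
have [cp|ncp] := pselect (cone v d k p); last first.
  have n := fold_pair_near pv ncp.
  apply/cont_box => e e0; have /cont_box/(_ e e0) c1 := phic (x := p).
  near=> q; rewrite (nbhs_singleton n) (near n q) //.
  by near: q.
apply: two_sheeted_cont.
have [rd|nd] := pselect (ray v d p); first by have [] := clean_creasy d0 s40 clean_mid rd pv.
have [rd|nup] := pselect (ray v up p); first by have [] := clean_creasy up0 s40 clean_up rd pv.
have [rd|ndn] := pselect (ray v dn p); first by have [] := clean_creasy dn0 s40 clean_dn rd pv.
by apply: flat_two_sheeted; exact: fold_pair_flat.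
Unshelve. all: by end_near. Qed.

(** In the frame of [d], [q1] and [q2] are the points [(1, s) + s/2 (s, -1)] and
    [(1, s) - s/2 (s, -1)] up to scale, mirror images across the upper ray; [q3] is the mirror image
    of [q1] across the central ray. They lie in three different sectors, and all three are mapped to
    [f q2]. *)
Lemma fold_pair_vertexy : vertexy psi v.
Proof.
pose vec (x y : R) : P := x *: d + y *: perp d.
have D0 := dotdd_gt0 d0.
move=> N Nv.
have [r1 r10 H1] := near_segment (vec (1 + s / 2 * s) (s / 2)) Nv.
have [r2 r20 H2] := near_segment (vec (1 - s / 2 * s) (s + s / 2)) Nv.
have [r3 r30 H3] := near_segment (vec (1 + s / 2 * s) (- (s / 2))) Nv.
pose r := Num.min r1 (Num.min r2 r3).
have r0 : 0 < r by rewrite !lt_min r10 r20 r30.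
have rr1 : `|r| <= r1 by rewrite gtr0_norm // ge_min lexx.
have rr2 : `|r| <= r2 by rewrite gtr0_norm // !ge_min lexx orbT.
have rr3 : `|r| <= r3 by rewrite gtr0_norm // !ge_min lexx !orbT.
have tE x y : t (v + r *: vec x y) = r * dot d d * x.
  by rewrite /t /vec /dot !ptE; ring.
have hE x y : h (v + r *: vec x y) = r * dot d d * y.
  by rewrite /h /vec /dot /crs !ptE; ring.
pose D := r * dot d d; have Dp : 0 < D by exact: mulr_gt0.
have Dk x y : x <= y -> D * x <= D * y by move=> xy; rewrite ler_pM2l.
have Dk' x y : x < y -> D * x < D * y by move=> xy; rewrite ltr_pM2l.
set q1 := v + r *: vec (1 + s / 2 * s) (s / 2).
set q2 := v + r *: vec (1 - s / 2 * s) (s + s / 2).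
set q3 := v + r *: vec (1 + s / 2 * s) (- (s / 2)).
have [i1 i2 i3] := sector_triple s0 s1 sk.
have r21 : refl v up q1 = q2.
  have n1 : 1 + s ^+ 2 != 0 by rewrite gt_eqF // ltr_pwDl // sqr_ge0.
  apply: (addIr (- v)); apply: (dot_crs_inj d0); apply: (mulfI n1).
    by rewrite dot_refl_tilt // -/(t q1) -/(h q1) -/(t q2) !tE hE; field.
  by rewrite crs_refl_tilt // -/(t q1) -/(h q1) -/(h q2) tE !hE; field.
have q13 : refl v d q3 = q1.
  apply: (addIr (- v)); apply: (dot_crs_inj d0).
    by rewrite dot_refl // -/(t q3) -/(t q1) !tE.
  by rewrite crs_refl // -/(h q3) -/(h q1) !hE; ring.
have e1 : psi q1 = f q2.
  have [ha hb] : 0 <= h q1 /\ h q1 <= s * t q1.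
    rewrite tE hE -/D; split; first by rewrite mulr_ge0 // ltW // divr_gt0.
    by rewrite [s * (D * _)]mulrCA; exact: Dk.
  by rewrite fold_pair_up // r21.
have e2 : psi q2 = f q2.
  apply: fold_pair_top; rewrite tE hE -/D.
    by rewrite [s * (D * _)]mulrCA; exact: Dk.
  by rewrite [k * (D * _)]mulrCA; exact: Dk'.
have e3 : psi q3 = f q2.
  have [ha hb] : h q3 <= 0 /\ - (s * t q3) <= h q3.
    rewrite tE hE -/D mulrN oppr_le0 lerN2; split.
      by rewrite mulr_ge0 // ltW // divr_gt0.
    by rewrite [s * (D * _)]mulrCA; exact: Dk.
  by rewrite fold_pair_dn // (refl_tilt_conj v s q3 d0) q13 r21.
exists q1, q2, q3; split; [exact: H1|exact: H2|exact: H3| |by rewrite e1 e2 e3].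
have dist x y x' y' : y != y' -> v + r *: vec x y <> v + r *: vec x' y'.
  move=> yy E; have : h (v + r *: vec x y) = h (v + r *: vec x' y') by rewrite E.
  by rewrite !hE => /mulfI e; move/eqP: yy; apply; apply: e; rewrite gt_eqF.
by have [n12 n13 n23] := sector_neq s0; split; exact: dist.
Qed.

End FoldPair.

(** The interface of a folding step: the drawing argument uses only these properties of the new map
    [psi], the new ray directions [w1] and [w2], and the common width [k'] of the three smaller
    cones. *)
Record crease_pair phi v d k psi k' w1 w2 : Prop := CreasePair {
  crease_pair_gt0 : 0 < k';
  crease_pair_neq1 : w1 != 0;
  crease_pair_neq2 : w2 != 0;
  crease_pair_cont : continuous psi;
  crease_pair_cases : exists g1 g2, [/\ good g1, good g2 &
    forall q, [\/ psi q = phi q, psi q = g1 q | psi q = g2 q]];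
  crease_pair_id : forall q, ~ cone v d k q -> psi q = phi q;
  crease_pair_near : forall q, q <> v -> ~ cone v d k q ->
    \forall r \near q, psi r = phi r;
  crease_pair_clean : clean psi v d k';
  crease_pair_clean1 : clean psi v w1 k';
  crease_pair_clean2 : clean psi v w2 k';
  crease_pair_sub : cone v d k' `<=` cone v d k;
  crease_pair_sub1 : cone v w1 k' `<=` cone v d k;
  crease_pair_sub2 : cone v w2 k' `<=` cone v d k;
  crease_pair_disj1 : forall q, cone v w1 k' q -> ~ cone v d k' q;
  crease_pair_disj2 : forall q, cone v w2 k' q -> ~ cone v d k' q;
  crease_pair_disj12 : forall q, cone v w1 k' q -> ~ cone v w2 k' q;
  crease_pair_vertexy : vertexy psi v;
  crease_pair_flat : forall q, cone v d k q ->
    ~ ray v d q -> ~ ray v w1 q -> ~ ray v w2 q -> flat psi q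
}.

Lemma exists_crease_pair phi v d k : d != 0 -> 0 < k -> continuous phi ->
  clean phi v d k -> exists psi k' w1 w2, crease_pair phi v d k psi k' w1 w2.
Proof.
move=> d0 k0 phic [f [gf gfd fv hf]].
have [rf sf] := gf; have [rfd sfd] := gfd.
have [s1 s10 H1] := slope_refl_near d0 rf sfd.
(* The upper reflected piece is close to [f \o refl v d]. The lower one is close to
   [f \o refl v d \o refl v d], which is [f]; so goodness of both old sides is used. *)
have sfdd : 0 < slope ((f \o refl v d) \o refl v d).
  have -> // : (f \o refl v d) \o refl v d = f.
  by apply/funext => q /=; rewrite reflK.
have [s2 s20 H2] := slope_refl_near d0 rfd sfdd.
pose s := Num.min (Num.min s1 s2) (Num.min (1 / 4) (k / 8)).
have s0 : 0 < s by rewrite !lt_min s10 s20 /= !divr_gt0.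
have ss1 : s <= s1 by rewrite !ge_min lexx.
have ss2 : s <= s2 by rewrite !ge_min lexx orbT.
have s4 : s <= 1 / 4 by rewrite !ge_min lexx !orbT.
have sk : 8 * s <= k.
  have : s <= k / 8 by rewrite !ge_min lexx !orbT.
  by lra.
have gup : good (f \o refl v (tilt d s)).
  split; first by apply: rigid_comp => //; apply: rigid_refl; exact: tilt_neq0.
  by apply: H1; rewrite gtr0_norm.
have gdn : good (f \o refl v d \o refl v (tilt d (- s))).
  split; first by apply: rigid_comp => //; apply: rigid_refl; exact: tilt_neq0.
  by apply: H2; rewrite normrN gtr0_norm.
exists (fold_pair phi v d f s), (s / 4), (tilt d s), (tilt d (- s)).
split.
- by rewrite divr_gt0.
- exact: tilt_neq0.
- exact: tilt_neq0.
- exact: (fold_pair_cont (k := k)).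
- exists (f \o refl v (tilt d s)), (f \o refl v d \o refl v (tilt d (- s))).
  by split=> // q; exact: fold_pair_cases.
- by move=> q; exact: fold_pair_id.
- by move=> q; exact: fold_pair_near.
- exact: (clean_mid (k := k)).
- exact: (clean_up (k := k)).
- exact: (clean_dn (k := k)).
- exact: cone_mid_sub.
- exact: cone_up_sub.
- exact: cone_dn_sub.
- by move=> q; exact: cone_up_mid.
- by move=> q; exact: cone_dn_mid.
- by move=> q; exact: cone_up_dn.
- exact: (fold_pair_vertexy (k := k)).
- by move=> q; exact: fold_pair_flat.
Qed.
End Pair.

(** * Classification of points *)

Section Classification.
Variable R : realType.
Local Notation P := 'rV[R]_2.
Implicit Types (p q v d w : P) (f g phi psi : P -> P) (fs : seq (P -> P)).

(** The regions are not recorded: continuity and finiteness of [fs] recover the local structure in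
    [near_piece], and finiteness also gives a uniform lower bound on the slopes. *)
Definition piecewise_good fs phi := (forall f, f \in fs -> good f) /\
  forall q, exists2 f, f \in fs & phi q = f q.

Lemma flat_unfolded phi p : flat phi p -> unfolded_point phi p.
Proof.
move=> [f /rigid_edist rf h]; exists [set q | phi q = f q]; split=> //.
by move=> q r /= -> ->; exact: rf.
Qed.

Lemma creasy_not_unfolded phi p : creasy phi p -> ~ unfolded_point phi p.
Proof.
move=> [_ h] [N [Np iN]]; have [q [r [Nq Nr qr E]]] := h N Np.
exact: qr (edist_inj iN Nq Nr E).
Qed.

Lemma creasy_crease phi p : creasy phi p -> crease_point phi p.
Proof.
move=> cp; split; first exact: creasy_not_unfolded.
have [[f [g [rf rg fp gp h]]] hN] := cp.
exists [set q | phi q = f q \/ phi q = g q], [set q | phi q = f q], [set q | phi q = g q], f, g.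
split=> //.
- by split; split=> //; exact: rigid_edist.
- move=> fg; have [q [r [Nq Nr qr E]]] := hN _ h.
  rewrite -fg /= in Nq Nr; apply: qr; apply: (rigid_inj rf).
  by case: Nq => <-; case: Nr => <-.
Qed.

Lemma vertexy_not_unfolded phi p : vertexy phi p -> ~ unfolded_point phi p.
Proof.
move=> h [N [Np iN]]; have [q [r [t [Nq Nr _ [qr _ _] [E _]]]]] := h N Np.
exact: qr (edist_inj iN Nq Nr E).
Qed.

Lemma vertexy_not_crease phi p : vertexy phi p -> ~ crease_point phi p.
Proof.
(* Two of three points with the same image lie in the same of the two pieces. *)
move=> h [_ [N [A [B [f [g [Np NE _ [[fi fA] [gi gB]] _]]]]]]].
have [q [r [t [Nq Nr Nt [qr qt rt] [Er Et]]]]] := h N Np.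
have hA a b : A a -> A b -> phi a = phi b -> a = b.
  by move=> Aa Ab E; apply: (edist_inj fi) => //; rewrite -!fA.
have hB a b : B a -> B b -> phi a = phi b -> a = b.
  by move=> Aa Ab E; apply: (edist_inj gi) => //; rewrite -!gB.
have Ert : phi r = phi t by rewrite -Er.
rewrite NE in Nq Nr Nt.
case: Nq => Hq; case: Nr => Hr; case: Nt => Ht;
  by [exact: qr (hA _ _ Hq Hr Er) | exact: qt (hA _ _ Hq Ht Et) | exact: rt (hA _ _ Hr Ht Ert)
     |exact: qr (hB _ _ Hq Hr Er) | exact: qt (hB _ _ Hq Ht Et) | exact: rt (hB _ _ Hr Ht Ert)].
Qed.

Lemma half_dist_separated (a b a' b' : R) :
  `|a - a'| < `|a - b| / 2 -> `|b - b'| < `|a - b| / 2 -> a' <> b'.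
Proof.
by move=> h1 h2 E; have := ler_distD a' a b; rewrite [`|a' - b|]distrC E in h1 *; lra.
Qed.

Lemma near_neq f g p : {for p, continuous f} -> {for p, continuous g} -> f p <> g p ->
  \forall q \near p, f q <> g q.
Proof.
move=> /cont_box cf /cont_box cg fg.
pose ex := `|xc (f p) - xc (g p)| / 2; pose ey := `|yc (f p) - yc (g p)| / 2.
have [hx|hx] := ltrP 0 ex.
  have h1 := cf _ hx; have h2 := cg _ hx; near=> q => E.
  have [h3 _] : `|xc (f p) - xc (f q)| < ex /\ `|yc (f p) - yc (f q)| < ex by near: q.
  have [h4 _] : `|xc (g p) - xc (g q)| < ex /\ `|yc (g p) - yc (g q)| < ex by near: q.
  by apply: (half_dist_separated h3 h4); rewrite E.
have [hy|hy] := ltrP 0 ey.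
  have h1 := cf _ hy; have h2 := cg _ hy; near=> q => E.
  have [_ h3] : `|xc (f p) - xc (f q)| < ey /\ `|yc (f p) - yc (f q)| < ey by near: q.
  have [_ h4] : `|xc (g p) - xc (g q)| < ey /\ `|yc (g p) - yc (g q)| < ey by near: q.
  by apply: (half_dist_separated h3 h4); rewrite E.
have half0 (a : R) : `|a| / 2 <= 0 -> a = 0.
  by rewrite pmulr_lle0 // normr_le0 => /eqP.
by case: fg; apply: ptP; apply/eqP; rewrite -subr_eq0; apply/eqP; exact: half0.
Unshelve. all: by end_near. Qed.

(** A piece that differs from [phi] at [p] differs from it on a whole neighbourhood by continuity.
    There are finitely many such pieces, so near [p] only those through [phi p] remain. *)
Lemma near_piece fs phi p : continuous phi -> piecewise_good fs phi ->
  \forall q \near p, exists2 f, f \in fs & f p = phi p /\ phi q = f q.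
Proof.
move=> phic [gfs hfs].
have H : \forall q \near p, forall f, f \in fs -> f p <> phi p -> f q <> phi q.
  have : forall f, f \in fs -> {for p, continuous f}.
    by move=> f /gfs[rf _]; exact: rigid_cont.
  elim: (fs) => [|f gs IH] hc; first by near=> q.
  have {}IH := IH (fun g hg => hc g (@mem_behead _ (f :: gs) g hg)).
  have [fp|fp] := pselect (f p = phi p).
    apply: filterS IH => q hq g; rewrite inE => /predU1P[->|]; [by [] | exact: hq].
  have n := near_neq (hc f (mem_head _ _)) (phic p) fp.
  apply: filterS (filterI IH n) => q [hq nq] g; rewrite inE => /predU1P[->|] //.
  exact: hq.
apply: filterS H => q hq; have [f fin E] := hfs q; exists f => //; split=> //.
by apply: contrapT => /(hq _ fin); apply.
Unshelve. all: by end_near. Qed.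

(** The covering consists of the agreement sets with the pieces through [phi p]. Three points with a
    common image must lie on three different isometries, each being injective, which also yields at
    least three pieces. *)
Lemma vertexy_vertex fs phi p : continuous phi -> piecewise_good fs phi ->
  vertexy phi p -> vertex_point phi p.
Proof.
move=> phic pg vp; split; [exact: vertexy_not_unfolded|exact: vertexy_not_crease|].
pose gs := [seq f <- fs | `[< f p = phi p >]].
pose N : set P := [set q | exists2 f, f \in gs & phi q = f q].
have Np : nbhs p N.
  apply: filterS (near_piece p phic pg) => q [f ffs [fp fq]].
  by exists f => //; rewrite mem_filter ffs andbT; apply/asboolP.
have gsP f : f \in gs -> f p = phi p /\ rigid f.
  by rewrite mem_filter => /andP[/asboolP ? /pg.1[]].
pose F (i : 'I_(size gs)) := nth id gs i.
have Fin i : F i \in gs by exact: mem_nth.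
have idx q : N q -> exists i, phi q = F i q.
  move=> [f fin E]; have lt : (index f gs < size gs)%N by rewrite index_mem.
  by exists (Ordinal lt); rewrite /F /= nth_index.
have [q [r [t [Nq Nr Nt [qr qt rt] [Er Et]]]]] := vp N Np.
have [[[i Ei] [j Ej]] [l El]] := (idx _ Nq, idx _ Nr, idx _ Nt).
have Fneq a b i' j' : phi a = F i' a -> phi b = F j' b -> phi a = phi b -> a <> b -> F i' <> F j'.
  move=> ha hb ab nab E; apply: nab; apply: (rigid_inj (gsP _ (Fin i')).2).
  by rewrite -ha ab hb E.
have Fij := Fneq _ _ _ _ Ei Ej Er qr.
have Fil := Fneq _ _ _ _ Ei El Et qt.
have Fjl : F j <> F l by apply: Fneq Ej El _ rt; rewrite -Er.
exists N, (size gs), (fun i => [set q | phi q = F i q]), F; split.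
- exact: Np.
- split.
    have u : uniq [:: i; j; l].
      rewrite /= !inE negb_or andbT -andbA; apply/and3P.
      by split; apply/eqP => E; [apply: Fij|apply: Fil|apply: Fjl]; rewrite E.
    by have := max_card (mem [:: i; j; l]); rewrite (card_uniqP u) card_ord.
  apply/seteqP; split=> a.
    by move=> /idx[i' E]; exists i'.
  by move=> [i' _ E]; exists (F i').
- by move=> i' /=; rewrite (gsP _ (Fin i')).1.
- by move=> i'; split=> //; apply: rigid_edist; exact: (gsP _ (Fin i')).2.
- by exists i, j, l.
Qed.

End Classification.

(** * Lifting the folding to an embedding in space *)

Section Embedding.
Variable R : realType.
Local Notation P := 'rV[R]_2.
Implicit Types (p q v d w : P) (f g phi psi : P -> P) (fs : seq (P -> P)).

(** The hypothesis compares [g s] only with the value at the centre [t], so the proof takes the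
    supremum of the points up to [b] where [g] has not dropped below [g a], and steps past it if it
    is less than [b]. *)
Lemma locally_nondecreasing (g : R -> R) :
  (forall t, exists2 e, 0 < e & forall s, `|s - t| < e ->
     (t <= s -> g t <= g s) /\ (s <= t -> g s <= g t)) ->
  forall a b, a <= b -> g a <= g b.
Proof.
move=> H a b ab.
pose A : set R := [set r | r <= b /\ g a <= g r /\ a <= r].
have Aa : A a by [].
have hA : has_sup A by split; [exists a | exists b => r [? _]].
have [e e0 he] := H (sup A); set m := sup A in he *.
have am : a <= m by exact: ub_le_sup hA.2 _ Aa.
have mb : m <= b by apply: ge_sup; [exists a | move=> r []].
have [r [rb [ar a_r]] mr] := sup_adherent e0 hA; rewrite -/m in mr.
have rm : r <= m by apply: ub_le_sup hA.2 _ _.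
have gm : g a <= g m.
  apply: le_trans ar _; have [|_] := he r; last exact.
  by rewrite ler0_norm ?subr_le0 //; lra.
have [bm|bm] := lerP b m; first by have -> : b = m by apply/eqP; rewrite eq_le bm mb.
pose s := Num.min b (m + e / 2).
have ms : m < s by rewrite lt_min bm /=; lra.
have se : s <= m + e / 2 by rewrite ge_min lexx orbT.
have : A s.
  split; first by rewrite ge_min lexx.
  split; last by lra.
  apply: le_trans gm _; have [|+ _] := he s; last by apply; exact: ltW.
  by rewrite gtr0_norm ?subr_gt0 //; lra.
move=> /(ub_le_sup hA.2); rewrite -/m; lra.
Qed.

Lemma slope_lower_bound fs : (forall f, f \in fs -> good f) ->
  exists2 c : R, 0 < c & forall f, f \in fs -> c <= slope f.
Proof.
elim: fs => [|f fs IH] h; first by exists 1.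
have [c c0 hc] := IH (fun g hg => h g (@mem_behead _ (f :: fs) g hg)).
have [_ sf] := h f (mem_head _ _).
exists (Num.min c (slope f)); first by rewrite lt_min c0.
move=> g; rewrite inE => /predU1P[->|gfs]; rewrite ge_min ?lexx ?orbT //.
by rewrite hc.
Qed.

(** With [c] a lower bound for the slopes, [xc (phi p) - c * xc p] is locally nondecreasing along a
    horizontal line: near each point, [phi] moves along a piece that agrees with it at that
    point. *)
Lemma horizontal_expansion fs phi : continuous phi -> piecewise_good fs phi ->
  exists2 c : R, 0 < c & forall p q, yc p = yc q ->
    c * `|xc p - xc q| <= `|xc (phi p) - xc (phi q)|.
Proof.
move=> phic pg; have [c c0 hc] := slope_lower_bound pg.1; exists c => //.
have mono y a b : a <= b ->
    xc (phi (pt a y)) - c * a <= xc (phi (pt b y)) - c * b.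
  apply: (@locally_nondecreasing (fun t => xc (phi (pt t y)) - c * t)) => t.
  have /nbhs_box[e e0 he] := near_piece (pt t y) phic pg.
  exists e => // s st; have [||f ffs [fp fq]] := he (pt s y).
  - by rewrite !ptE distrC.
  - by rewrite !ptE subrr normr0.
  have [rf _] := pg.1 f ffs.
  have := @rigid_horizontal _ f (pt t y) (pt s y) rf; rewrite !ptE fp -fq => /(_ erefl) E.
  have := hc f ffs => cf.
  have E' : xc (phi (pt s y)) - c * s - (xc (phi (pt t y)) - c * t) = (slope f - c) * (s - t).
    by rewrite mulrBl -E; ring.
  split=> ts; rewrite -subr_ge0 ?E'; first by rewrite mulr_ge0 // subr_ge0.
  by rewrite -opprB E' -mulrN opprB mulr_ge0 // subr_ge0.
have ord p q : yc p = yc q -> xc p <= xc q ->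
    c * `|xc p - xc q| <= `|xc (phi p) - xc (phi q)|.
  move=> yy xx; have := mono (yc p) _ _ xx.
  have -> : pt (xc p) (yc p) = p by apply: ptP; rewrite !ptE.
  have -> : pt (xc q) (yc p) = q by apply: ptP; rewrite !ptE.
  rewrite (distrC (xc p)) (distrC (xc (phi p))) ger0_norm ?subr_ge0 // => h.
  by apply: le_trans (ler_norm _); lra.
move=> p q yy; case/orP: (le_total (xc p) (xc q)) => xx; first exact: ord.
by rewrite (distrC (xc p)) (distrC (xc (phi p))); exact: ord (esym yy) xx.
Qed.

Definition graph_lift phi p : 'rV[R]_3 :=
  \row_(j < 3) (if j == 0 then xc (phi p) else if j == 1 then yc (phi p) else yc p).

Lemma ball_graph_lift phi p q (e : R) : 0 < e -> ball (graph_lift phi p) e (graph_lift phi q) <->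
  [/\ `|xc (phi p) - xc (phi q)| < e, `|yc (phi p) - yc (phi q)| < e & `|yc p - yc q| < e].
Proof.
move=> e0; split.
- move=> [_ h]; split.
  + by have := h 0 0; rewrite /graph_lift !mxE.
  + by have := h 0 1; rewrite /graph_lift !mxE.
  + by have := h 0 (2%:R); rewrite /graph_lift !mxE.
- move=> [h1 h2 h3]; split=> // i j; rewrite /graph_lift !mxE.
  by case: ifP => // _; case: ifP.
Qed.

Lemma graph_lift_embedding fs phi : continuous phi -> piecewise_good fs phi ->
  topological_embedding (graph_lift phi).
Proof.
move=> phic pg; have [c c0 hc] := horizontal_expansion phic pg.
have inv p (U : set P) : nbhs p U ->
    exists2 e : R, 0 < e & forall q, ball (graph_lift phi p) e (graph_lift phi q) -> U q.
  move=> /nbhs_box[e e0 he].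
  have ce : 0 < c * e / 2 by rewrite divr_gt0 // mulr_gt0.
  have /cont_box/(_ _ ce) /nbhs_box[a a0 ha] := phic p.
  exists (Num.min (c * e / 2) (Num.min a e)); first by rewrite !lt_min ce a0.
  move=> q /ball_graph_lift; rewrite !lt_min ce a0 e0 => /(_ isT).
  move=> [/andP[h1 _] _ /and3P[_ h2 h3]]; apply: he => //.
  (* The auxiliary point has the abscissa of [p] and the ordinate of [q]. Continuity at [p] controls
     its image, and expansion on the horizontal line of [q] then bounds the difference of abscissas;
     each comparison costs [c * e / 2]. *)
  have [||h4 _] := ha (pt (xc p) (yc q)); rewrite ?ptE ?subrr ?normr0 //.
  have := hc (pt (xc p) (yc q)) q; rewrite !ptE => /(_ erefl) h5.
  rewrite -(ltr_pM2l c0); apply: le_lt_trans h5 _.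
  apply: le_lt_trans (ler_distD (xc (phi p)) _ _) _.
  by rewrite (distrC _ (xc (phi p))); lra.
split.
- move=> p N /nbhs_ballP[e /= e0 he].
  suff : \forall q \near p, N (graph_lift phi q) by [].
  have /cont_box/(_ _ e0) h := phic p.
  have h' : \forall q \near p, `|yc p - yc q| < e by apply/nbhs_box; exists e.
  near=> q; apply: he; apply/ball_graph_lift => //.
  have [h1 h2] : `|xc (phi p) - xc (phi q)| < e /\ `|yc (phi p) - yc (phi q)| < e.
    by near: q.
  by split=> //; near: q.
- move=> p q E.
  have E1 : xc (phi p) = xc (phi q).
    by have := congr1 (fun z : 'rV[R]_3 => z 0 0) E; rewrite /graph_lift !mxE.
  have E2 : yc p = yc q.
    by have := congr1 (fun z : 'rV[R]_3 => z 0 2%:R) E; rewrite /graph_lift !mxE.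
  apply: ptP => //; have := hc _ _ E2; rewrite E1 subrr normr0 pmulr_rle0 //.
  by rewrite normr_le0 subr_eq0 => /eqP.
(* The points of space all of whose preimages lie in [U] form a set with the right trace on the
   range; by [inv] every image of a point of [U] is interior to it. *)
- move=> U oU; exists (interior [set z | forall q, graph_lift phi q = z -> U q]).
  split; first exact: open_interior.
  apply/seteqP; split=> z.
  + move=> [p Up <-]; split; last by exists p.
    have [e e0 he] := inv p U (open_nbhs_nbhs (conj oU Up)).
    by apply/nbhs_ballP; exists e => // y hy q E; apply: he; rewrite E.
  + by move=> [/interior_subset h [q _ E]]; exists q => //; exact: h.
Unshelve. all: by end_near. Qed.

Lemma vertical_proj_graph_lift phi p : vertical_proj (graph_lift phi p) = phi p.
Proof.
by apply: ptP; rewrite /xc /yc /vertical_proj /graph_lift !mxE.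
Qed.

Lemma edistpp p : Defs.edist p p = 0.
Proof. by rewrite edistE !subrr expr0n addr0 sqrtr0. Qed.

End Embedding.

(** * Plane drawings of subtrees *)

Section Attach.
Variables (T : finType) (e : rel T).
Hypothesis He : is_tree e.

Definition connected_in (D : {set T}) := forall x y, x \in D -> y \in D ->
  connect [rel a b | [&& e a b, a \in D & b \in D]] x y.

Lemma connected_in1 x : connected_in [set x].
Proof. by move=> a b /set1P -> /set1P ->; exact: connect0. Qed.

Lemma connected_attach (D : {set T}) c x : connected_in D -> x \in D -> e x c ->
  connected_in (c |: D).
Proof.
have [sym _ _ _] := He; move=> Dc xD xc.
have old a b : a \in D -> b \in D ->
    connect [rel a b | [&& e a b, a \in c |: D & b \in c |: D]] a b.
  move=> aD bD; apply: connect_sub (Dc a b aD bD) => u v /= /and3P[uv uD vD].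
  by apply: connect1; rewrite /= uv !inE uD vD !orbT.
move=> a b /setU1P[->|aD] /setU1P[->|bD].
- exact: connect0.
- by apply: connect_trans (old x b xD bD); apply: connect1; rewrite /= sym xc !inE eqxx xD orbT.
- by apply: connect_trans (old a x aD xD) _; apply: connect1; rewrite /= xc !inE eqxx xD orbT.
- exact: old.
Qed.

(** Two neighbours of [c] in [D], joined by a simple path inside [D], would close up to a cycle of
    length at least three. Cycles of length two are only edges run back and forth. *)
Lemma unique_attach (D : {set T}) c x z : connected_in D -> c \notin D ->
  x \in D -> z \in D -> e c x -> e c z -> z = x.
Proof.
have [sym _ _ acyc] := He; move=> Dc cD xD zD cx cz; apply: contraTeq isT => zx.
have /connectP[p0 p0p zE] := Dc x z xD zD.
move: zE zx; case/shortenP: p0p => p pp up _ zE zx.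
have pe : path e x p by apply: sub_path pp => a b /= /andP[].
have pD : {subset p <= D}.
  elim: (p) (x) pp => //= b q IH a /andP[/and3P[_ _ bD] /IH h] t.
  by rewrite inE => /predU1P[->|/h].
have : ucycle e (c :: x :: p).
  apply/andP; split; first by rewrite /= rcons_path pe cx -zE sym cz.
  rewrite cons_uniq up andbT inE negb_or; apply/andP; split.
    by apply: contraNneq cD => ->.
  by apply: contra cD => /pD.
move=> /acyc; case: p zE {pp up pe pD} zx => [/= ->|//]; by rewrite eqxx.
Qed.

End Attach.

Section Drawing.
Variables (R : realType) (T : finType) (e : rel T) (root : T).
Hypothesis He : is_tree e.
Local Notation P := 'rV[R]_2.

(** Each edge is stored at its end away from the root. [par], [dir] and [wid] are meant for drawn
    nodes other than the root, and [pos] for nodes that have been placed. *)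
Record drawing := Drawing {
  fold : P -> P; par : T -> T; pos : T -> P; dir : T -> P; wid : T -> R }.

Implicit Types (g : drawing) (D S : {set T}).

(* The edge from [par g y] to [y]: a segment if [y] is in [S], the set of nodes that
   have a position, and otherwise a ray, still free to be subdivided. *)
Definition edge_set S g y : set P := [set q | ray (pos g (par g y)) (dir g y) q /\
  (y \in S -> dot (dir g y) (q - pos g (par g y)) <= dot (dir g y) (dir g y))].

Definition wedge g y : set P := cone (pos g (par g y)) (dir g y) (wid g y).

Definition nbrs D x := [set y in root |: D | e x y]%SET.

(** [D] holds the drawn nodes other than the root, [S] the placed ones. The fields on [fold]
    identify the crease pattern with the drawn edges, [s_adj] says that the tree edges among drawn
    nodes are exactly the parent edges, and the fields on [wedge] keep the room around each free ray
    empty, which makes every later step local. *)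
Record state D S g : Prop := State {
  s_root : root \notin D;
  s_rootS : root \in S;
  s_sub : forall y, y \in S -> y \in root |: D;
  s_conn : connected_in e (root |: D);
  s_par : forall y, y \in D -> par g y \in S /\ e (par g y) y;
  s_adj : forall x y, x \in root |: D -> y \in root |: D -> e x y ->
    (y \in D /\ x = par g y) \/ (x \in D /\ y = par g x);
  s_pos : forall y, y \in S -> y \in D -> pos g y = pos g (par g y) + dir g y;
  s_dir : forall y, y \in D -> dir g y != 0;
  s_cont : continuous (fold g);
  s_good : exists fs, piecewise_good fs (fold g);
  (* A node with two drawn neighbours is still an interior point of a straight crease. *)
  s_vertexy : forall x, x \in S -> (2 < #|nbrs D x|)%N -> vertexy (fold g) (pos g x);
  s_creasy : forall y p, y \in D -> edge_set S g y p -> (forall x, x \in S -> p <> pos g x) ->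
    creasy (fold g) p;
  s_flat : forall p, (forall y, y \in D -> ~ edge_set S g y p) -> flat (fold g) p;
  s_pos_edge : forall x y, x \in S -> y \in D -> edge_set S g y (pos g x) -> x = y \/ x = par g y;
  s_edge_edge : forall y z p, y \in D -> z \in D -> y <> z -> edge_set S g y p -> edge_set S g z p ->
    exists2 x, x \in S & p = pos g x;
  s_inj : forall x y, x \in S -> y \in S -> pos g x = pos g y -> x = y;
  s_wid : forall y, y \in D -> y \notin S -> 0 < wid g y;
  s_clean : forall y, y \in D -> y \notin S ->
    clean (fold g) (pos g (par g y)) (dir g y) (wid g y);
  s_wedge_edge : forall y z q, y \in D -> y \notin S -> z \in D -> z <> y ->
    edge_set S g z q -> ~ wedge g y q;
  s_wedge_pos : forall y x, y \in D -> y \notin S -> x \in S -> ~ wedge g y (pos g x);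
  s_wedge_wedge : forall y z q, y \in D -> y \notin S -> z \in D -> z \notin S -> y <> z ->
    wedge g y q -> ~ wedge g z q
}.

Lemma shift_sub (v d : P) : v + d - v = d.
Proof. by rewrite addrC addKr. Qed.

Lemma dot_shift (d p v : P) : dot d (p - (v + d)) = dot d (p - v) - dot d d.
Proof. by rewrite /dot !ptE; ring. Qed.

Lemma crs_shift (d p v : P) : crs d (p - (v + d)) = crs d (p - v).
Proof. by rewrite /crs !ptE; ring. Qed.

Lemma refl_shift (v d q : P) : d != 0 -> refl (v + d) d q = refl v d q.
Proof.
move=> d0; have hd := dot_refl (v + d) q d0; have hc := crs_refl (v + d) q d0.
rewrite !dot_shift in hd; rewrite !crs_shift in hc.
apply: (addIr (- v)); apply: (dot_crs_inj d0).
- by rewrite (dot_refl v q d0); exact: addIr hd.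
- by rewrite hc (crs_refl v q d0).
Qed.

Lemma cone_shift (v d : P) k : 0 < k -> d != 0 -> cone (v + d) d k `<=` cone v d k.
Proof.
move=> k0 /dotdd_gt0 D0 q; rewrite /cone /= dot_shift crs_shift => h.
by apply: lt_trans h _; rewrite ltr_pM2l // ltrBlDr ltrDl.
Qed.

Lemma cone_apex_shift (v d : P) k : 0 < k -> d != 0 -> cone v d k (v + d).
Proof.
move=> k0 /dotdd_gt0 D0; rewrite /cone /= shift_sub.
have -> : crs d d = 0 by rewrite /crs; ring.
by rewrite normr0 mulr_gt0.
Qed.

Lemma clean_shift phi (v d : P) k : 0 < k -> d != 0 -> clean phi v d k -> clean phi (v + d) d k.
Proof.
move=> k0 d0 [f [gf gfd fv hf]].
have E : refl (v + d) d = refl v d by apply/funext => q; exact: refl_shift.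
exists f; rewrite E; split=> //.
- rewrite hf; last exact: cone_apex_shift.
  have -> : crs d (v + d - v) = 0 by rewrite shift_sub /crs; ring.
  by rewrite lexx.
- by move=> q /(cone_shift k0 d0) /hf ->; rewrite crs_shift E.
Qed.

Lemma ray_shift (v d q : P) : d != 0 -> ray (v + d) d q <-> ray v d q /\ dot d d <= dot d (q - v).
Proof.
move=> /dotdd_gt0 D0; rewrite /ray /= crs_shift dot_shift subr_ge0.
by split=> [[? h]|[[? ?] ?]] //; split=> //; split=> //; apply: le_trans h; exact: ltW.
Qed.

Lemma nbrs_attach D c x z : connected_in e (root |: D) -> c \notin root |: D ->
  x \in root |: D -> e x c -> z \in root |: D -> z <> x -> nbrs (c |: D) z = nbrs D z.
Proof.
have [sym _ _ _] := He.
move=> Dc cD xD xc zD zx; apply/setP => a; rewrite !inE.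
case: (eqVneq a c) => [->|//]; rewrite orbT /=; have -> : e z c = false.
  apply: contra_notF zx => zc; apply: (unique_attach He Dc cD xD zD); by rewrite sym.
by rewrite andbF.
Qed.

Lemma nbrs_extend D S g y c : state D S g -> y \in D -> y \notin S -> c \notin root |: D ->
  e y c -> nbrs (c |: D) y = [set par g y; c]%SET.
Proof.
have [sym _ _ _] := He; move=> st yD yS cDr yc.
have yDr : y \in root |: D by rewrite inE yD orbT.
have [pyS pye] := s_par st yD.
apply/setP => a; rewrite !inE; apply/idP/idP.
  move=> /andP[aD ya]; have [/eqP ->|ac] := boolP (a == c); first by rewrite orbT.
  rewrite (negbTE ac) /= in aD.
  have aDr : a \in root |: D by rewrite !inE.
  have [[aD' E]|[_ ->]] := s_adj st yDr aDr ya; last by rewrite eqxx.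
  by have [] := s_par st aD'; rewrite -E (negbTE yS).
case/orP => /eqP ->; last by rewrite eqxx orbT.
by have := s_sub st pyS; rewrite !inE => /orP[->|->]; rewrite ?orbT /= sym pye.
Qed.

(** The map does not change. The free ray of [y] is cut at [v + d], where [y] is placed; any other
    point of the open ray would do, since its wedge is empty. The part beyond becomes the free ray
    of [c], with a shifted wedge contained in the old one. *)
Lemma state_extend D S g y c : state D S g -> y \in D -> y \notin S -> c \notin root |: D ->
  e y c -> exists2 g', state (c |: D) (y |: S) g' & par g' c = y.
Proof.
have [sym irr _ _] := He.
move=> st yD yS cDr yc.
have cD : c \notin D by apply: contra cDr; rewrite inE => ->; rewrite orbT.
have cr : c != root by apply: contraNneq cDr => ->; rewrite inE set11.
have yr : y != root by apply: contraNneq (s_root st) => <-.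
have cy : c != y by apply: contraNneq cD => ->.
have cS : c \notin S by apply: contra cDr => /(s_sub st).
have [pyS pye] := s_par st yD.
have yDr : y \in root |: D by rewrite inE yD orbT.
pose v := pos g (par g y); pose d := dir g y; pose k := wid g y.
have d0 : d != 0 := s_dir st yD.
have k0 : 0 < k := s_wid st yD yS.
pose g' := Drawing (fold g) (fun z => if z == c then y else par g z)
  (fun z => if z == y then v + d else pos g z)
  (fun z => if z == c then d else dir g z) (fun z => if z == c then k else wid g z).
have neqc z : z \in D -> (z == c) = false by move=> zD; apply: contraNF cD => /eqP <-.
have parE z : z \in D -> par g' z = par g z by move=> /neqc /= ->.
have dirE z : z \in D -> dir g' z = dir g z by move=> /neqc /= ->.
have widE z : z \in D -> wid g' z = wid g z by move=> /neqc /= ->.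
have posE z : z \in S -> pos g' z = pos g z.
  by move=> zS /=; case: eqP => // E; rewrite -E zS in yS.
have ppE z : z \in D -> pos g' (par g' z) = pos g (par g z).
  by move=> zD; rewrite parE // posE //; have [] := s_par st zD.
have posy : pos g' y = v + d by rewrite /= eqxx.
have parc : par g' c = y by rewrite /= eqxx.
have dirc : dir g' c = d by rewrite /= eqxx.
have widc : wid g' c = k by rewrite /= eqxx.
have wedgeE z : z \in D -> wedge g' z = wedge g z.
  by move=> zD; rewrite /wedge ppE // dirE // widE.
have wedgec : wedge g' c `<=` wedge g y.
  by rewrite /wedge parc posy dirc widc; exact: cone_shift.
have edgeE z : z \in D -> z <> y -> edge_set (y |: S) g' z = edge_set S g z.
  move=> zD /eqP/negbTE zy; rewrite /edge_set ppE // dirE //.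
  by rewrite in_setU1 zy.
have edgey q : edge_set (y |: S) g' y q <-> ray v d q /\ dot d (q - v) <= dot d d.
  rewrite /edge_set ppE // dirE // setU11 -/v -/d.
  by split=> [[h1 h2]|[h1 h2]]; split=> //; exact: h2.
have edgec q : edge_set (y |: S) g' c q <-> ray v d q /\ dot d d <= dot d (q - v).
  apply: iff_trans (ray_shift v q d0); rewrite /edge_set parc dirc posy in_setU1 (negbTE cy) (negbTE cS).
  by split=> [[]|].
have edge_y q : edge_set S g y q <-> ray v d q.
  by rewrite /edge_set /= (negbTE yS); split=> [[]|].
have edge_split q : edge_set S g y q -> edge_set (y |: S) g' y q \/ edge_set (y |: S) g' c q.
  move=> /edge_y rq; have [h|h] := lerP (dot d (q - v)) (dot d d).
    by left; apply/edgey.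
  by right; apply/edgec; split => //; exact: ltW.
have edge_sub q z : z = y \/ z = c -> edge_set (y |: S) g' z q -> edge_set S g y q.
  by case=> -> => [/edgey[? _]|/edgec[? _]]; apply/edge_y.
have posw : wedge g y (v + d) by exact: cone_apex_shift.
have apex_nw : ~ wedge g' c (v + d).
  rewrite /wedge parc posy dirc widc /cone /mkset subrr => h.
  have := le_lt_trans (normr_ge0 _) h.
  by rewrite /dot !ptE !mulr0 addr0 mulr0 ltxx.
have inD z : z \in c |: D -> z = c \/ z \in D by move=> /setU1P.
have inS z : z \in y |: S -> z = y \/ z \in S by move=> /setU1P.
(* Every new edge lies in an old one, [z0], and only the two halves of the ray of [y] share theirs.
   This reduces most fields to the old state. *)
have old z : z \in c |: D -> exists2 z0, z0 \in D & (forall q, edge_set (y |: S) g' z q ->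
    edge_set S g z0 q) /\ ((z = z0 /\ z <> y) \/ (z0 = y /\ (z = y \/ z = c))).
  move=> /inD[->|zD].
    by exists y => //; split; [move=> q; apply: edge_sub; right | right; split=> //; right].
  have [->|/eqP zy] := eqVneq z y.
    by exists y => //; split; [move=> q; apply: edge_sub; left | right; split=> //; left].
  by exists z => //; split; [move=> q; rewrite edgeE | left].
exists g'; last exact: parc.
split.
- by rewrite in_setU1 negb_or eq_sym cr (s_root st).
- by rewrite in_setU1 (s_rootS st) orbT.
- by move=> z /inS[->|/(s_sub st)]; rewrite !inE ?yD ?orbT // => /orP[->|->]; rewrite ?orbT.
- by rewrite finset.setUCA; apply: connected_attach yc => //; exact: s_conn st.
- move=> z /inD[->|zD]; first by rewrite parc setU11.
  by rewrite parE // in_setU1; have [-> ->] := s_par st zD; rewrite orbT.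
- move=> a b; rewrite finset.setUCA => /setU1P[->|aD] /setU1P[->|bD] ab.
  + by rewrite irr in ab.
  + right; rewrite setU11 parc; split=> //.
    by apply: (unique_attach He (s_conn st) cDr yDr bD) => //; rewrite sym.
  + left; rewrite setU11 parc; split=> //.
    by apply: (unique_attach He (s_conn st) cDr yDr aD) => //; rewrite sym.
  + have [[bD' ->]|[aD' ->]] := s_adj st aD bD ab.
      by left; rewrite parE // in_setU1 bD' orbT.
    by right; rewrite parE // in_setU1 aD' orbT.
- move=> z /inS[->|zS] /inD[zc|zD].
  + by rewrite zc eqxx in cy.
  + by rewrite posy ppE // dirE.
  + by rewrite zc (negbTE cS) in zS.
  + by rewrite posE // ppE // dirE // (s_pos st zS).
- by move=> z /inD[->|zD]; rewrite ?dirc // dirE // (s_dir st).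
- exact: s_cont st.
- exact: s_good st.
- move=> x /inS[->|xS].
    by rewrite (nbrs_extend st) // cards2; case: (_ != _).
  rewrite posE // (nbrs_attach (s_conn st) cDr yDr yc); [exact: s_vertexy st x xS| exact: s_sub st _ xS|].
  by move=> xy; rewrite xy (negbTE yS) in xS.
- move=> z p zD hz hp; have [z0 z0D [sub _]] := old _ zD.
  apply: (s_creasy st z0D); first exact: sub.
  by move=> x xS; rewrite -posE //; apply: hp; rewrite in_setU1 xS orbT.
- move=> p hp; apply: (s_flat st) => z zD hz.
  have [zy|/eqP zy] := eqVneq z y; last by apply: (hp z); rewrite ?edgeE // in_setU1 zD orbT.
  rewrite zy in hz; have [h|h] := edge_split _ hz.
    by apply: hp h; rewrite in_setU1 yD orbT.
  by apply: hp h; rewrite setU11.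
- move=> x z /inS[->|xS] zD hz.
    have [z0 z0D [sub [[E zy]|[_ [->|->]]]]] := old _ zD.
    + rewrite posy in hz; rewrite -E in z0D sub.
      by case: (s_wedge_edge st yD yS z0D zy (sub _ hz)).
    + by left.
    + by right; rewrite parc.
  rewrite posE // in hz; have [z0 z0D [sub H]] := old _ zD.
  have := s_pos_edge st xS z0D (sub _ hz).
  case: H => [[-> zy]|[z0y [zy|zc]]].
  + by rewrite parE // -E.
  + by rewrite zy z0y parE.
  (* A placed node on the outer half of the ray would lie in the reserved wedge of [y], since that
     half excludes the apex [v]. *)
  + exfalso; have := s_wedge_pos st yD yS xS; apply.
    rewrite zc in hz; move/edgec: hz => [rq h]; apply: ray_cone => // E.
    by move: h; rewrite E subrr /dot !ptE !mulr0 addr0 leNgt; move: (dotdd_gt0 d0) => ->.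
- move=> a b p aD bD ab ha hb.
  have [a0 a0D [suba Ha]] := old _ aD; have [b0 b0D [subb Hb]] := old _ bD.
  have [E|/eqP nE] := eqVneq a0 b0; last first.
    have [x xS ->] := s_edge_edge st a0D b0D nE (suba _ ha) (subb _ hb).
    by exists x; rewrite ?posE // in_setU1 xS orbT.
  have [ey ec] : edge_set (y |: S) g' y p /\ edge_set (y |: S) g' c p.
    have ay : a = y \/ a = c.
      by case: Ha => [[E1 n1]|[_]] //; case: Hb => [[E2 n2]|[E2 _]]; congruence.
    have by' : b = y \/ b = c.
      by case: Hb => [[E1 n1]|[_]] //; case: Ha => [[E2 n2]|[E2 _]]; congruence.
    case: ay ha by' hb ab => -> ha [] -> hb ab; by [split | case: ab].
  exists y; rewrite ?setU11 // posy; move/edgey: ey => [[h1 _] h2]; move/edgec: ec => [_ h3].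
  apply: (addIr (- v)); apply: (dot_crs_inj d0).
    by rewrite shift_sub; apply/eqP; rewrite eq_le h2.
  by rewrite h1 shift_sub /crs; ring.
- have ny x : x \in S -> pos g x <> v + d.
    by move=> xS E; have := s_wedge_pos st yD yS xS; rewrite E.
  move=> a b /inS[->|aS] /inS[->|bS] //; rewrite ?posy ?posE //.
  + by move=> E; case: (ny b).
  + by move=> E; case: (ny a).
  + exact: (s_inj st aS bS).
- move=> z /inD[->|zD] zS; first by rewrite widc.
  by rewrite widE //; apply: (s_wid st) => //; apply: contra zS => h; rewrite in_setU1 h orbT.
- move=> z /inD[->|zD] zS; first by rewrite parc posy dirc widc; exact: (clean_shift k0 d0 (s_clean st yD yS)).
  by rewrite ppE // dirE // widE //; apply: (s_clean st) => //; apply: contra zS => h; rewrite in_setU1 h orbT.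
- move=> z w q /inD[->|zD] zS wD wz hw.
    move=> hq; have hyq := wedgec _ hq.
    have [w0 w0D [sub [[E wy]|[_ [wy|//]]]]] := old _ wD.
      by rewrite -E in w0D sub; exact: (s_wedge_edge st yD yS w0D wy (sub _ hw)).
    rewrite wy in hw; move/edgey: hw => [_ h].
    move: hq; rewrite /wedge parc posy dirc widc => /(cone_dot_gt0 k0).
    by rewrite dot_shift subr_gt0 ltNge h.
  have zS' : z \notin S by apply: contra zS => h; rewrite in_setU1 h orbT.
  have zy : z <> y by move=> E; rewrite E setU11 in zS.
  rewrite wedgeE //; have [w0 w0D [sub [[E wy]|[w0y _]]]] := old _ wD.
    by apply: (s_wedge_edge st zD zS' w0D _ (sub _ hw)); rewrite -E.
  by apply: (s_wedge_edge st zD zS' w0D _ (sub _ hw)); rewrite w0y => /esym.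
- move=> z x /inD[->|zD] zS /inS[->|xS].
  + by rewrite posy.
  + by rewrite posE // => /wedgec; exact: (s_wedge_pos st yD yS xS).
  + have zS' : z \notin S by apply: contra zS => h; rewrite in_setU1 h orbT.
    have yz : y <> z by move=> E; rewrite -E setU11 in zS.
    by rewrite posy wedgeE //; exact: (s_wedge_wedge st yD yS zD zS' yz posw).
  + have zS' : z \notin S by apply: contra zS => h; rewrite in_setU1 h orbT.
    by rewrite posE // wedgeE //; exact: (s_wedge_pos st zD zS' xS).
- have aux z q : z \in D -> z \notin y |: S -> wedge g' c q -> ~ wedge g' z q.
    move=> zD zS /wedgec hq; rewrite wedgeE //.
    have zS' : z \notin S by apply: contra zS => h; rewrite in_setU1 h orbT.
    have yz : y <> z by move=> E; rewrite -E setU11 in zS.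
    exact: (s_wedge_wedge st yD yS zD zS' yz hq).
  move=> a b q /inD[->|aD] aS /inD[->|bD] bS ab //.
  + exact: aux.
  + by move=> ha hb; exact: (aux a q).
  + rewrite !wedgeE //; apply: (s_wedge_wedge st) => //.
      by apply: contra aS => h; rewrite in_setU1 h orbT.
    by apply: contra bS => h; rewrite in_setU1 h orbT.
Qed.

End Drawing.

(** * Drawing two more neighbours by a folding step *)

Section Branch.
Variables (R : realType) (T : finType) (e : rel T) (root : T).
Hypothesis He : is_tree e.
Local Notation P := 'rV[R]_2.
Local Notation state := (state e root).
Local Notation nbrs := (nbrs e root).
Local Notation drawing := (drawing R T).
Implicit Types (g : drawing) (D S : {set T}).

(** The folding step takes place in the reserved wedge [K] of the free ray of [c], and the new rays
    go to [c1] and [c2]. Outside [K] the map is unchanged, and apart from the ray of [c] the old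
    pattern never enters [K]. *)
Lemma state_branch D S g c c1 c2 : state D S g -> c \in D -> c \notin S ->
  c1 \notin root |: D -> c2 \notin root |: D -> c1 != c2 ->
  e (par g c) c1 -> e (par g c) c2 ->
  exists2 g' : drawing, state (c1 |: (c2 |: D)) S g' & forall z, z \in D -> par g' z = par g z.
Proof.
have [sym irr _ _] := He.
move=> st cD cS c1Dr c2Dr c12 xc1 xc2.
pose x := par g c; rewrite -/x in xc1 xc2.
have xS : x \in S by have [] := s_par st cD.
have xDr := s_sub st xS.
pose v := pos g x; pose d := dir g c; pose k := wid g c.
have d0 : d != 0 := s_dir st cD.
have k0 : 0 < k := s_wid st cD cS.
have [psi [k' [w1 [w2 pair]]]] := exists_crease_pair d0 k0 (s_cont st) (s_clean st cD cS).
pose K := cone v d k.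
have KE : wedge g c = K by [].
have sub_root z : z \in D -> z \in root |: D by rewrite inE orbC => ->.
have c1D : c1 \notin D by apply: contra c1Dr; exact: sub_root.
have c2D : c2 \notin D by apply: contra c2Dr; exact: sub_root.
have c1S : c1 \notin S by apply: contra c1Dr; exact: (s_sub st).
have c2S : c2 \notin S by apply: contra c2Dr; exact: (s_sub st).
have c1r : c1 != root by apply: contraNneq c1Dr => ->; rewrite inE set11.
have c2r : c2 != root by apply: contraNneq c2Dr => ->; rewrite inE set11.
have neq1 z : z \in D -> (z == c1) = false by move=> zD; apply: contraNF c1D => /eqP <-.
have neq2 z : z \in D -> (z == c2) = false by move=> zD; apply: contraNF c2D => /eqP <-.
have c21 : (c2 == c1) = false by rewrite eq_sym (negbTE c12).
pose g' := Drawing psi (fun z => if (z == c1) || (z == c2) then x else par g z) (pos g)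
  (fun z => if z == c1 then w1 else if z == c2 then w2 else dir g z)
  (fun z => if [|| z == c, z == c1 | z == c2] then k' else wid g z).
have posE : pos g' = pos g by [].
have parE z : z \in D -> par g' z = par g z by move=> zD; rewrite /= neq1 ?neq2.
have dirE z : z \in D -> dir g' z = dir g z by move=> zD; rewrite /= neq1 ?neq2.
have parc1 : par g' c1 = x by rewrite /= eqxx.
have parc2 : par g' c2 = x by rewrite /= eqxx orbT.
have dirc1 : dir g' c1 = w1 by rewrite /= eqxx.
have dirc2 : dir g' c2 = w2 by rewrite /= c21 eqxx.
have widc : wid g' c = k' by rewrite /= eqxx.
have widc1 : wid g' c1 = k' by rewrite /= eqxx orbT.
have widc2 : wid g' c2 = k' by rewrite /= eqxx !orbT.
have widE z : z \in D -> z <> c -> wid g' z = wid g z.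
  by move=> zD /eqP/negbTE zc; rewrite /= zc neq1 ?neq2.
have edgeE z : z \in D -> edge_set S g' z = edge_set S g z.
  by move=> zD; rewrite /edge_set parE // dirE.
have wedgeE z : z \in D -> z <> c -> wedge g' z = wedge g z.
  by move=> zD zc; rewrite /wedge parE // dirE // widE.
have wedge_c : wedge g' c = cone v d k' by rewrite /wedge parE // dirE // widc.
have wedge_c1 : wedge g' c1 = cone v w1 k' by rewrite /wedge parc1 dirc1 widc1.
have wedge_c2 : wedge g' c2 = cone v w2 k' by rewrite /wedge parc2 dirc2 widc2.
have ray_edge z q : z \notin S -> edge_set S g' z q <-> ray (pos g' (par g' z)) (dir g' z) q.
  by move=> /negbTE zS; rewrite /edge_set zS; split=> [[]|].
have edge_c q : edge_set S g' c q <-> ray v d q by rewrite ray_edge // parE // dirE.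
have edge_c1 q : edge_set S g' c1 q <-> ray v w1 q by rewrite ray_edge // parc1 dirc1.
have edge_c2 q : edge_set S g' c2 q <-> ray v w2 q by rewrite ray_edge // parc2 dirc2.
have k'0 := crease_pair_gt0 pair.
have w10 := crease_pair_neq1 pair.
have w20 := crease_pair_neq2 pair.
(* The three rays issuing from [v] inside [K] are treated alike: their smaller wedges lie in [K] and
   are disjoint, and their rays minus [v] lie in their wedges. *)
pose br z := [\/ z = c, z = c1 | z = c2].
have br_sub z : br z -> wedge g' z `<=` K.
  case=> ->; [rewrite wedge_c|rewrite wedge_c1|rewrite wedge_c2].
  - exact: (crease_pair_sub pair).
  - exact: (crease_pair_sub1 pair).
  - exact: (crease_pair_sub2 pair).
have br_edge z q : br z -> edge_set S g' z q -> q <> v -> wedge g' z q.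
  by case=> ->; [rewrite wedge_c => /edge_c|rewrite wedge_c1 => /edge_c1|rewrite wedge_c2 => /edge_c2];
    exact: ray_cone.
have br_disj y z q : br y -> br z -> y <> z -> wedge g' y q -> ~ wedge g' z q.
  have h1 := crease_pair_disj1 pair; have h2 := crease_pair_disj2 pair.
  have h12 := crease_pair_disj12 pair.
  case=> -> [] -> // _; rewrite ?wedge_c ?wedge_c1 ?wedge_c2 => a b.
  - exact: h1 b a.
  - exact: h2 b a.
  - exact: h1 a b.
  - exact: h12 a b.
  - exact: h2 a b.
  - exact: h12 b a.
have br_clean z : br z -> clean psi (pos g' (par g' z)) (dir g' z) (wid g' z).
  case=> ->.
  - by rewrite widc parE // dirE //; exact: (crease_pair_clean pair).
  - by rewrite widc1 parc1 dirc1; exact: (crease_pair_clean1 pair).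
  - by rewrite widc2 parc2 dirc2; exact: (crease_pair_clean2 pair).
have br_par z : br z -> par g' z = x by case=> ->; rewrite ?parc1 ?parc2 ?parE.
have inD z : z \in c1 |: (c2 |: D) -> br z \/ (z \in D /\ z <> c).
  move=> /setU1P[->|/setU1P[->|zD]].
  - by left; constructor 2.
  - by left; constructor 3.
  - by have [->|/eqP zc] := eqVneq z c; [left; constructor 1 | right].
have posK z : z \in S -> ~ K (pos g z) by move=> zS; exact: (s_wedge_pos st cD cS zS).
have edgeK z q : z \in D -> z <> c -> edge_set S g z q -> ~ K q.
  by move=> zD zc; exact: (s_wedge_edge st cD cS zD zc).
have wedgeK z q : z \in D -> z \notin S -> z <> c -> wedge g z q -> ~ K q.
  by move=> zD zS zc; exact: (s_wedge_wedge st zD zS cD cS zc).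
have brS z : br z -> z \notin S by case=> ->.
have c1D2 : c1 \notin root |: (c2 |: D).
  by rewrite !inE !negb_or c1r c12.
have conn2 : connected_in e (root |: (c2 |: D)).
  by rewrite finset.setUCA; exact: (connected_attach He (s_conn st) xDr xc2).
have xDr2 : x \in root |: (c2 |: D) by rewrite finset.setUCA in_setU1 xDr orbT.
have fid q : ~ K q -> psi q = fold g q := @crease_pair_id _ _ _ _ _ _ _ _ _ pair q.
exists g'; last exact: parE.
split.
- by rewrite !inE !negb_or eq_sym c1r eq_sym c2r (s_root st).
- exact: (s_rootS st).
- by move=> y /(s_sub st); rewrite !inE => /orP[->|->]; rewrite ?orbT.
- by rewrite finset.setUCA; exact: (connected_attach He conn2 xDr2 xc1).
- move=> z /inD[bz|[zD zc]]; last by rewrite parE //; exact: (s_par st zD).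
  by rewrite br_par //; split=> //; case: bz => -> //; have [] := s_par st cD.
- have aux1 b : b \in root |: (c2 |: D) -> e c1 b -> b = x.
    by move=> bD cb; apply: (unique_attach He conn2 c1D2 xDr2 bD) => //; rewrite sym.
  have aux2 b : b \in root |: D -> e c2 b -> b = x.
    by move=> bD cb; apply: (unique_attach He (s_conn st) c2Dr xDr bD) => //; rewrite sym.
  have i1 : c1 \in c1 |: (c2 |: D) by rewrite setU11.
  have i2 : c2 \in c1 |: (c2 |: D) by rewrite in_setU1 setU11 orbT.
  have cases a : a \in root |: (c1 |: (c2 |: D)) -> [\/ a = c1, a = c2 | a \in root |: D].
    rewrite !inE => /orP[->|/orP[/eqP|/orP[/eqP|->]]]; rewrite ?orbT.
    - by constructor 3.
    - by constructor 1.
    - by constructor 2.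
    - by constructor 3.
  have up a : a \in root |: D -> a \in root |: (c2 |: D).
    by rewrite !inE => /orP[->|->]; rewrite ?orbT.
  have c2in : c2 \in root |: (c2 |: D) by rewrite !inE eqxx orbT.
  move=> a b /cases[->|->|aD] /cases[->|->|bD] ab.
  + by rewrite irr in ab.
  + by right; rewrite parc1; split=> //; exact: aux1.
  + by right; rewrite parc1; split=> //; apply: aux1 => //; exact: up.
  + by left; rewrite parc1; split=> //; apply: aux1 => //; rewrite sym.
  + by rewrite irr in ab.
  + by right; rewrite parc2; split=> //; exact: aux2.
  + by left; rewrite parc1; split=> //; apply: aux1; [exact: up | rewrite sym].
  + by left; rewrite parc2; split=> //; apply: aux2 => //; rewrite sym.
  + have [[bD' ->]|[aD' ->]] := s_adj st aD bD ab.
      by left; rewrite parE // !in_setU1 bD' !orbT.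
    by right; rewrite parE // !in_setU1 aD' !orbT.
- move=> z zS /inD[/brS|[zD _]]; first by rewrite zS.
  by rewrite posE parE // dirE // (s_pos st zS zD).
- by move=> z /setU1P[->|/setU1P[->|zD]]; rewrite ?dirc1 ?dirc2 // dirE // (s_dir st).
- exact: (crease_pair_cont pair).
- have [fs [gfs hfs]] := s_good st.
  have [g1 [g2 [gg1 gg2 h]]] := crease_pair_cases pair.
  exists [:: g1, g2 & fs]; split.
    by move=> f; rewrite !inE => /or3P[/eqP ->|/eqP ->|/gfs].
  move=> q /=; case: (h q) => ->.
  + by have [f ffs ->] := hfs q; exists f => //; rewrite !inE ffs !orbT.
  + by exists g1 => //; rewrite inE eqxx.
  + by exists g2 => //; rewrite !inE eqxx orbT.
- move=> z zS; rewrite posE; have [->|zx] := eqVneq z x; first by move=> _; exact: (crease_pair_vertexy pair).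
  have zDr := s_sub st zS.
  have zx' : z <> x by exact/eqP.
  have zDr2 : z \in root |: (c2 |: D).
    by move: zDr; rewrite !inE => /orP[->|->]; rewrite ?orbT.
  rewrite (nbrs_attach He conn2 c1D2 xDr2 xc1 zDr2 zx').
  rewrite (nbrs_attach He (s_conn st) c2Dr xDr xc2 zDr zx').
  move=> /(s_vertexy st zS); apply: near_vertexy; apply: (crease_pair_near pair).
    by move=> /(s_inj st zS xS).
  exact: posK.
- move=> z p zD' hz hp; have pv : p <> v by exact: hp.
  have [bz|[zD zc]] := inD _ zD'; last first.
    rewrite edgeE // in hz; apply: near_creasy (s_creasy st zD hz hp).
    by apply: (crease_pair_near pair) => //; exact: edgeK hz.
  have [rz /= zS] := (hz.1, brS _ bz).
  case: bz rz => -> rz.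
  + by apply: clean_creasy (crease_pair_clean pair) _ pv => //; rewrite parE // dirE // in rz.
  + by apply: clean_creasy (crease_pair_clean1 pair) _ pv => //; rewrite parc1 dirc1 in rz.
  + by apply: clean_creasy (crease_pair_clean2 pair) _ pv => //; rewrite parc2 dirc2 in rz.
- move=> p hp; have inD' z : z \in D -> z \in c1 |: (c2 |: D) by rewrite !in_setU1 => ->; rewrite !orbT.
  have nc : ~ ray v d p by move=> /edge_c; apply: hp; exact: inD'.
  have [Kp|nK] := pselect (K p).
    apply: (crease_pair_flat pair) => //.
    + by move=> /edge_c1; apply: hp; rewrite setU11.
    + by move=> /edge_c2; apply: hp; rewrite in_setU1 setU11 orbT.
  apply: near_flat (s_flat st _).
    apply: (crease_pair_near pair) => // pv; apply: nc; rewrite pv /ray /= subrr.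
    by rewrite /crs /dot !ptE !mulr0 subr0 addr0.
  by move=> z zD; rewrite -edgeE //; apply: hp; exact: inD'.
- move=> y z yS /inD[bz|[zD zc]] hz; last first.
    by rewrite edgeE // in hz; rewrite parE //; exact: (s_pos_edge st yS zD hz).
  right; rewrite br_par //; apply: (s_inj st yS xS); apply: contrapT => yv.
  exact: posK yS (br_sub _ bz _ (br_edge _ _ bz hz yv)).
- have xv : exists2 y, y \in S & v = pos g y by exists x.
  move=> y z p /inD[By|[yD yc]] /inD[bz|[zD zc]] yz hy hz.
  + have [->//|/eqP pv] := eqVneq p v.
    by case: (br_disj _ _ p By bz yz); exact: br_edge.
  + have [->//|/eqP pv] := eqVneq p v; rewrite edgeE // in hz.
    by case: (edgeK _ _ zD zc hz); apply: (br_sub _ By); exact: br_edge.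
  + have [->//|/eqP pv] := eqVneq p v; rewrite edgeE // in hy.
    by case: (edgeK _ _ yD yc hy); apply: (br_sub _ bz); exact: br_edge.
  + by rewrite !edgeE // in hy hz *; exact: (s_edge_edge st yD zD yz hy hz).
- exact: (s_inj st).
- move=> z /inD[bz|[zD zc]] zS; last by rewrite widE //; exact: (s_wid st zD zS).
  by case: bz => ->; rewrite ?widc ?widc1 ?widc2.
- move=> z /inD[bz|[zD zc]] zS; first exact: br_clean.
  rewrite parE // dirE // widE //; have [f [gf gfd fv hf]] := s_clean st zD zS.
  have [pzS _] := s_par st zD.
  exists f; split=> //; first by rewrite fv /= fid //; exact: posK.
  by move=> q hq; rewrite /= fid ?hf //; exact: (wedgeK _ _ zD zS zc hq).
- move=> y z q /inD[By|[yD yc]] yS /inD[bz|[zD zc]] zy hz.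
  + have [->|/eqP pv] := eqVneq q v; first by move=> /(br_sub _ By); exact: posK.
    by apply: (br_disj z y) => //; exact: br_edge.
  + by rewrite edgeE // in hz; move=> /(br_sub _ By); exact: edgeK hz.
  + rewrite wedgeE //; have [->|/eqP pv] := eqVneq q v; first exact: (s_wedge_pos st yD yS xS).
    move=> hy; apply: (wedgeK _ _ yD yS yc hy); apply: (br_sub _ bz); exact: br_edge.
  + by rewrite edgeE // in hz; rewrite wedgeE //; exact: (s_wedge_edge st yD yS zD zy hz).
- move=> y z /inD[By|[yD yc]] yS zS; first by move=> /(br_sub _ By); exact: posK.
  by rewrite wedgeE //; exact: (s_wedge_pos st yD yS zS).
- move=> y z q /inD[By|[yD yc]] yS /inD[bz|[zD zc]] zS yz hy hz.
  + exact: br_disj yz hy hz.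
  + by rewrite wedgeE // in hz; exact: (wedgeK _ _ zD zS zc hz) (br_sub _ By _ hy).
  + by rewrite wedgeE // in hy; exact: (wedgeK _ _ yD yS yc hy) (br_sub _ bz _ hz).
  + by rewrite !wedgeE // in hy hz; exact: (s_wedge_wedge st yD yS zD zS yz hy hz).
Qed.

End Branch.

(** * Growing the drawing to the whole tree *)

Section Build.
Variables (R : realType) (T : finType) (e : rel T) (root : T).
Hypothesis He : is_tree e.
Local Notation P := 'rV[R]_2.
Local Notation state := (@state R T e root).
Local Notation nbrs := (nbrs e root).
Local Notation drawing := (drawing R T).
Implicit Types (g : drawing) (D S : {set T}).

Lemma cone_opp (d : P) k q : 0 < k -> cone 0 d k q -> ~ cone 0 (- d) k q.
Proof.
move=> k0 /(cone_dot_gt0 k0) h1 /(cone_dot_gt0 k0) h2.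
by move: h1 h2; rewrite /dot !ptE; lra.
Qed.

(** The crease of the single fold is the x-axis: [c1] receives the positive half and [c2] the
    negative half. The root has only two drawn neighbours, so it need not be a vertex yet. *)
Lemma state_base c1 c2 : c1 != c2 -> e root c1 -> e root c2 ->
  exists2 g, state [set c1; c2]%SET [set root]%SET g & forall z, par g z = root.
Proof.
have [sym irr _ _] := He; move=> c12 rc1 rc2.
have c1r : c1 != root by apply: contraTneq rc1 => ->; rewrite irr.
have c2r : c2 != root by apply: contraTneq rc2 => ->; rewrite irr.
have c21 : (c2 == c1) = false by rewrite eq_sym (negbTE c12).
pose ex : P := pt 1 0.
have crsE q : crs ex q = yc q by rewrite /crs !ptE; ring.
have dotE q : dot ex q = xc q by rewrite /dot !ptE; ring.
have crsN q : crs (- ex) q = - yc q by rewrite /crs !ptE; ring.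
have dotN q : dot (- ex) q = - xc q by rewrite /dot !ptE; ring.
have ex0 : ex != 0 by apply/eqP => /(congr1 (@xc R)); rewrite !ptE => /eqP; rewrite oner_eq0.
have nex0 : - ex != 0 by rewrite oppr_eq0.
pose phi q := if 0 <= crs ex (q - 0) then (@idfun P) q else (@idfun P) (refl 0 ex q).
have rid : rigid (@idfun P).
  exists 1, 0, 1, 0, 0; split; rewrite ?expr1n ?expr0n ?addr0 //.
  by move=> p; apply: ptP; rewrite !ptE /=; ring.
have gid : good (@idfun P).
  by split=> //; rewrite /slope /= !ptE subr0 ltr01.
have grefl : good (refl 0 ex).
  split; first exact: rigid_refl.
  by rewrite /slope /refl !dotE !ptE subr0; lra.
have fold0 : fold_on setT 0 ex idfun phi by [].
have reflN q : refl 0 (- ex) q = refl 0 ex q.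
  by rewrite /refl !dotE !dotN; apply: ptP; rewrite !ptE; field.
have E1 : idfun \o refl 0 ex = refl 0 ex by [].
have E2 : refl 0 ex \o refl 0 (- ex) = idfun.
  by apply/funext => q /=; rewrite reflN reflK.
have phi0 : phi 0 = 0 by rewrite /phi crsE subr0 ptE lexx.
have clean1 : clean phi 0 ex 1.
  by exists idfun; rewrite E1; split.
have clean2 : clean phi 0 (- ex) 1.
  (* Seen along the opposite direction the two sides of the crease are exchanged, so the isometry on
     the left is now the reflection. *)
  exists (refl 0 ex); rewrite E2; split=> //; first by rewrite phi0 refl_center.
  move=> q _; rewrite /phi crsE crsN reflN reflK //= oppr_ge0.
  case: ltgtP => // yq; rewrite refl_fixed //.
  by rewrite crsE.
pose g := Drawing phi (fun=> root) (fun=> 0) (fun z => if z == c1 then ex else - ex) (fun=> 1 : R).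
have dirc1 : dir g c1 = ex by rewrite /= eqxx.
have dirc2 : dir g c2 = - ex by rewrite /= c21.
have rD : root \notin [set c1; c2]%SET by rewrite !inE negb_or eq_sym c1r eq_sym c2r.
have notS z : z \in [set c1; c2]%SET -> z \notin [set root]%SET.
  by rewrite !inE => /orP[/eqP ->|/eqP ->].
have edgeE z q : z \in [set c1; c2]%SET -> edge_set [set root]%SET g z q <-> ray 0 (dir g z) q.
  by move=> /notS/negbTE zS; rewrite /edge_set zS; split=> [[]|].
have inD z : z \in [set c1; c2]%SET -> z = c1 \/ z = c2.
  by rewrite !inE => /orP[/eqP ->|/eqP ->]; [left|right].
have in1 : c1 \in [set c1; c2]%SET by rewrite !inE eqxx.
have in2 : c2 \in [set c1; c2]%SET by rewrite !inE eqxx orbT.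
have ray_eq0 (q : P) : ray 0 ex q -> ray 0 (- ex) q -> q = 0.
  rewrite /ray /= crsE crsN dotE dotN subr0 => -[h1 h2] [_ h3].
  by apply: ptP; rewrite ptE //; lra.
have apex0 (d : P) : ~ cone 0 d 1 0.
  by rewrite /cone /= subrr /dot !ptE !mulr0 addr0 mulr0 ltNge normr_ge0.
have ray_in_cone (d q : P) : d != 0 -> ray 0 d q -> q <> 0 -> cone 0 d 1 q.
  by move=> d0; apply: ray_cone.
have r0 : connected_in e [set root]%SET by exact: connected_in1.
have c1n : c1 \notin [set root]%SET by rewrite inE.
have rin : root \in [set root]%SET by rewrite inE.
have e12 : e c1 c2 = false.
  apply/negP => h12.
  have c1' := connected_attach He r0 rin rc1.
  have := @unique_attach T e He (c1 |: [set root])%SET c2 root c1 c1'.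
  rewrite !inE negb_or c21 c2r !eqxx orbT sym rc2 sym h12 => /(_ isT isT isT isT isT) E.
  by rewrite E eqxx in c1r.
have rootD z : z \in root |: [set c1; c2]%SET -> [\/ z = root, z = c1 | z = c2].
  by rewrite !inE => /or3P[] /eqP ->; [constructor 1|constructor 2|constructor 3].
exists g; last by [].
split=> //.
- by move=> y /set1P ->; rewrite !inE eqxx.
- have E : root |: [set c1; c2]%SET = c2 |: (c1 |: [set root])%SET.
    by apply/setP => z; rewrite !inE; do ![case: (_ == _)].
  rewrite E; apply: (connected_attach He (x := root)) => //; last by rewrite !inE eqxx orbT.
  exact: (connected_attach He r0 rin rc1).
- by move=> y /inD[->|->]; rewrite inE eqxx.
- move=> x y /rootD[] -> /rootD[] ->; rewrite ?irr ?e12 // 1?sym ?e12 // => _;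
    by [left|right].
- by move=> y /set1P ->; rewrite (negbTE rD).
- by move=> y /inD[->|->]; rewrite ?dirc1 ?dirc2.
- move=> p; apply: two_sheeted_cont; have [h|h] := eqVneq (crs ex (p - 0)) 0.
    by have [] := fold_on_creasy ex0 rid fold0 (filterT) h.
  by apply: flat_two_sheeted; apply: fold_on_flat ex0 rid fold0 (filterT) h.
- exists [:: idfun; refl 0 ex]; split.
    by move=> f; rewrite !inE => /orP[/eqP ->|/eqP ->].
  move=> q /=; rewrite /phi; case: ifP => _.
    by exists idfun; rewrite ?inE ?eqxx.
  by exists (refl 0 ex); rewrite ?inE ?eqxx ?orbT.
- move=> x /set1P ->.
  suff -> : nbrs [set c1; c2]%SET root = [set c1; c2]%SET by rewrite cards2; case: (_ != _).
  apply/setP => z; rewrite !inE; apply/idP/idP.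
    by case/andP=> /or3P[/eqP ->|->|->]; rewrite ?irr ?orbT.
  by case/orP => /eqP ->; rewrite eqxx ?rc1 ?rc2 !orbT.
- move=> y p yD /(edgeE _ _ yD) [h _] _; apply: fold_on_creasy ex0 rid fold0 (filterT) _.
  move: h; case: (inD _ yD) => ->; first by rewrite dirc1.
  by rewrite dirc2 crsN crsE => /eqP; rewrite oppr_eq0 => /eqP.
- move=> p hp; apply: (fold_on_flat ex0 rid fold0 (filterT)).
  apply/eqP => h; have [hx|hx] := lerP 0 (xc p).
    by apply: (hp c1 in1); apply/edgeE => //; rewrite dirc1 /ray /= h dotE subr0.
  apply: (hp c2 in2); apply/edgeE => //; rewrite dirc2 /ray /= crsN dotN -crsE h oppr0 subr0.
  by split=> //; rewrite oppr_ge0 ltW.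
- by move=> x y /set1P -> yD _; right.
- move=> y z p yD zD yz /(edgeE _ _ yD) hy /(edgeE _ _ zD) hz; exists root; rewrite ?inE //=.
  case: (inD _ yD) yz hy => -> yz; case: (inD _ zD) yz hz => -> // yz;
    rewrite ?dirc1 ?dirc2 => h1 h2; exact: ray_eq0.
- by move=> x y /set1P -> /set1P ->.
- by move=> y /inD[->|->] _; rewrite ?dirc1 ?dirc2.
- move=> y z q yD _ zD zy /(edgeE _ _ zD) hz.
  have [->|/eqP q0] := eqVneq q 0; first exact: apex0.
  rewrite /wedge /=; case: (inD _ yD) zy => -> zy; case: (inD _ zD) zy hz => -> // zy;
    rewrite ?dirc1 ?dirc2 ?eqxx ?c21 => hz.
  + by move=> hc; apply: (cone_opp ltr01 hc); exact: ray_in_cone.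
  + by apply: cone_opp => //; exact: ray_in_cone.
- by move=> y x yD _ _; exact: apex0.
- move=> y z q yD _ zD _ yz; rewrite /wedge /=.
  case: (inD _ yD) yz => -> yz; case: (inD _ zD) yz => -> // yz; rewrite ?eqxx ?c21.
  + by apply: cone_opp.
  + by move=> h1 h2; apply: (cone_opp ltr01 h2).
Qed.

Hypothesis Hdeg : forall x : T, internal e x -> ~~ odd (degree e x) /\ (2 < degree e x)%N.

(** [g_even] makes missing neighbours come in pairs, and [g_active] guarantees a free ray to fold
    around at every placed node whose neighbours are not all drawn. *)
Record growing D S g : Prop := Growing {
  g_state : state D S g;
  g_internal : forall x, x \in S -> internal e x;
  g_even : forall x, x \in S -> ~~ odd #|nbrs D x|;
  g_active : forall x z, x \in S -> e x z -> z \notin root |: D ->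
    exists c, [/\ c \in D, c \notin S & par g c = x] }.

Lemma growing_branch D S g x z : growing D S g -> x \in S -> e x z -> z \notin root |: D ->
  exists D' g', growing D' S g' /\ D \proper D'.
Proof.
move=> gr xS xz zD; have st := g_state gr; have [sym _ _ _] := He.
pose M := [set y | e x y & y \notin root |: D]%SET.
have zM : z \in M by rewrite inE xz.
have nM : #|nbrs D x| + #|M| = degree e x.
  rewrite /degree -(cardsID (root |: D) [set y | e x y]%SET); congr (_ + _)%N.
    by apply: eq_card => y; rewrite !inE andbC.
  by apply: eq_card => y; rewrite !inE andbC.
have oM : ~~ odd #|M|.
  (* Drawn and undrawn neighbours add up to an even degree, so there is an even number of undrawn
     ones, and besides [z] there is another. *)
  have [od _] := Hdeg (g_internal gr xS).
  by rewrite -nM oddD (negbTE (g_even gr xS)) in od.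
have [z2 z2M z2z] : exists2 z2, z2 \in M & z2 != z.
  have : (0 < #|M :\ z|)%N.
    by rewrite lt0n; apply: contraNneq oM => M0; rewrite (cardsD1 z) zM M0.
  by case/card_gt0P => z2; rewrite in_setD1 => /andP[? ?]; exists z2.
have /andP[xz2 z2D] : e x z2 && (z2 \notin root |: D) by move: z2M; rewrite inE.
have [c [cD cS pc]] := g_active gr xS xz zD.
have zz2 : z != z2 by rewrite eq_sym.
have pz : e (par g c) z by rewrite pc.
have pz2 : e (par g c) z2 by rewrite pc.
have [g' st' parE] := state_branch He st cD cS zD z2D zz2 pz pz2.
have xDr := s_sub st xS.
have conn2 : connected_in e (root |: (z2 |: D)).
  by rewrite finset.setUCA; exact: (connected_attach He (s_conn st) xDr xz2).
have xDr2 : x \in root |: (z2 |: D) by rewrite finset.setUCA in_setU1 xDr orbT.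
have zr : z != root by apply: contraNneq zD => ->; rewrite inE set11.
have z2r : z2 != root by apply: contraNneq z2D => ->; rewrite inE set11.
have zD' : z \notin D by apply: contra zD; rewrite inE orbC => ->.
have z2D' : z2 \notin D by apply: contra z2D; rewrite inE orbC => ->.
have zD2 : z \notin root |: (z2 |: D).
  by rewrite !inE !negb_or zr eq_sym z2z.
exists (z |: (z2 |: D)), g'; split; last first.
  rewrite properE; apply/andP; split.
    by apply/fintype.subsetP => y yD; rewrite !in_setU1 yD !orbT.
  by apply/fintype.subsetPn; exists z => //; rewrite setU11.
split=> //.
- exact: (g_internal gr).
- move=> y yS; have [->|/eqP yx] := eqVneq y x.
    have -> : nbrs (z |: (z2 |: D)) x = z |: (z2 |: nbrs D x).
      apply/setP => a; rewrite !inE.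
      have [->|_] := eqVneq a z; first by rewrite xz !orbT.
      by have [->|_] := eqVneq a z2; first by rewrite xz2 !orbT.
    rewrite !cardsU1 !inE (negbTE zr) (negbTE zD') (negbTE z2r) (negbTE z2D').
    by rewrite eq_sym (negbTE z2z) /= negbK; exact: (g_even gr xS).
  have yDr := s_sub st yS.
  rewrite (nbrs_attach He conn2 zD2 xDr2 xz _ yx).
    by rewrite (nbrs_attach He (s_conn st) z2D xDr xz2 yDr yx); exact: (g_even gr yS).
  by rewrite finset.setUCA in_setU1 yDr orbT.
- move=> y w yS yw wD.
  have [c0 [c0D c0S pc0]] : exists c, [/\ c \in D, c \notin S & par g c = y].
    apply: (g_active gr yS yw); apply: contra wD; rewrite !in_setU1.
    by case/orP => ->; rewrite ?orbT.
  by exists c0; rewrite parE // !in_setU1 c0D !orbT.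
Qed.

(** Placing [y] uses up what may be the last free ray at its parent. The second hypothesis makes
    this harmless: no placed node has an undrawn neighbour, so [g_active] remains to be checked only
    at [y], where [c] provides the ray. *)
Lemma growing_extend D S g y : growing D S g ->
  (forall x z, x \in S -> e x z -> z \in root |: D) ->
  y \in D -> y \notin S -> internal e y ->
  exists D' S' g', growing D' S' g' /\ D \proper D'.
Proof.
move=> gr full yD yS yi; have st := g_state gr; have [sym _ _ _] := He.
have [pyS pye] := s_par st yD.
have yDr : y \in root |: D by rewrite in_setU1 yD orbT.
have [c yc cp] : exists2 c, e y c & c != par g y.
  have : (0 < #|[set z | e y z]%SET :\ par g y|)%N.
    have := yi; rewrite /internal /degree (cardsD1 (par g y)) inE sym pye.
    by rewrite add1n ltnS.
  by case/card_gt0P => c; rewrite !inE => /andP[? ?]; exists c.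
have cD : c \notin root |: D.
  apply/negP => cD; have [[cD' E]|[_ E]] := s_adj st yDr cD yc.
    by have [] := s_par st cD'; rewrite -E (negbTE yS).
  by rewrite E eqxx in cp.
have [g' st' pc] := state_extend He st yD yS cD yc.
have cS : c \notin S by apply: contra cD; exact: (s_sub st).
have cy : c != y by apply: contraNneq cD => ->.
exists (c |: D), (y |: S), g'; split; last first.
  rewrite properE; apply/andP; split.
    by apply/fintype.subsetP => z zD; rewrite !in_setU1 zD !orbT.
  apply/fintype.subsetPn; exists c; first by rewrite setU11.
  by apply: contra cD; rewrite in_setU1 orbC => ->.
split=> //.
- by move=> x /setU1P[->|/(g_internal gr)].
- move=> x /setU1P[->|xS].
    by rewrite (nbrs_extend He st) // cards2 eq_sym cp.
  rewrite (nbrs_attach He (s_conn st) cD yDr yc (s_sub st xS)); first exact: (g_even gr xS).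
  by move=> E; rewrite E (negbTE yS) in xS.
- move=> x z /setU1P[->|xS] xz zD.
    by exists c; rewrite setU11 in_setU1 negb_or cy.
  by have := full x z xS xz; rewrite !inE in zD *; case/orP=> h; rewrite h ?orbT in zD.
Qed.

Lemma exists_full_state : internal e root -> exists D S g, [/\ state D S g,
  forall z, z \in root |: D & forall x, (x \in S) = internal e x].
Proof.
have [sym irr con _] := He; move=> ri.
have [D0 [S0 [g0 gr0]]] : exists D S g, growing D S g.
  have : (1 < #|[set y | e root y]%SET|)%N by exact: ri.
  case/card_gt1P => c1 [c2 []]; rewrite !inE => rc1 rc2 c12.
  have [g st parE] := state_base c12 rc1 rc2.
  exists [set c1; c2]%SET, [set root]%SET, g; split=> //.
  - by move=> x /set1P ->.
  - move=> x /set1P ->.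
    suff -> : nbrs [set c1; c2]%SET root = [set c1; c2]%SET by rewrite cards2 c12.
    apply/setP => z; rewrite !inE; apply/idP/idP.
      by case/andP=> /or3P[/eqP ->|->|->]; rewrite ?irr ?orbT.
    by case/orP => /eqP ->; rewrite eqxx ?rc1 ?rc2 !orbT.
  - move=> x z /set1P -> _ _; exists c1; rewrite parE !inE eqxx; split=> //.
    by apply: contraTneq rc1 => ->; rewrite irr.
(* Both kinds of step enlarge [D], so the number of undrawn nodes decreases; branching is tried
   before placing. *)
have [n] := ubnP (#|T| - #|D0|)%N; elim: n D0 S0 g0 gr0 => // n IH D S g gr hn.
have grow D' S' g' : growing D' S' g' -> D \proper D' -> exists D S g, [/\ state D S g,
    forall z, z \in root |: D & forall x, (x \in S) = internal e x].
  move=> gr' /proper_card pD; apply: IH gr' _.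
  have := max_card (mem D'); rewrite -ltnS; move: hn pD; rewrite !ltnS => hn pD _.
  apply: leq_trans hn; apply: ltn_sub2l => //; apply: leq_trans pD _; exact: max_card.
have [full|] := pselect (forall x z, x \in S -> e x z -> z \in root |: D); last first.
  move=> /existsNP[x /existsNP[z /not_implyP[xS /not_implyP[xz /negP zD]]]].
  by have [D' [g' [gr' pD]]] := growing_branch gr xS xz zD; exact: grow gr' pD.
have [leaf|] := pselect (forall y, y \in D -> internal e y -> y \in S); last first.
  move=> /existsNP[y /not_implyP[yD /not_implyP[yi /negP yS]]].
  by have [D' [S' [g' [gr' pD]]]] := growing_extend gr full yD yS yi; exact: grow gr' pD.
have st := g_state gr.
(* Follow a path from the root. The neighbours of a placed node are drawn, and a drawn node that is
   not placed is a leaf, whose only neighbour is its parent. *)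
have all z : z \in root |: D.
  have /connectP[p pp ->] := con root z.
  suff: forall p b, b \in root |: D -> path e b p -> last b p \in root |: D.
    by apply=> //; rewrite setU11.
  elim=> [//|a q IHp] b bD /= /andP[ba pa].
  apply: IHp => //; have [bS|bS] := boolP (b \in S); first exact: full bS ba.
  have bD' : b \in D.
    by move: bD; rewrite in_setU1 => /predU1P[E|//]; rewrite E (s_rootS st) in bS.
  have [pbS pbe] := s_par st bD'.
  have : ~~ internal e b by apply: contra bS; exact: leaf.
  rewrite /internal -leqNgt => /card_le1_eqP h.
  have -> : a = par g b by apply: h; rewrite inE // sym.
  exact: (s_sub st pbS).
exists D, S, g; split=> // x; apply/idP/idP; first exact: (g_internal gr).
move=> xi; have := all x; rewrite in_setU1 => /predU1P[->|xD]; first exact: (s_rootS st).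
exact: leaf.
Qed.

End Build.

(** * Reading the tree off the folding *)

Section Realization.
Variables (R : realType) (T : finType) (e : rel T) (root : T).
Hypothesis He : is_tree e.
Hypothesis Hdeg : forall x : T, internal e x -> ~~ odd (degree e x) /\ (2 < degree e x)%N.
Local Notation P := 'rV[R]_2.
Variables (D S : {set T}) (g : drawing R T).
Hypothesis st : state e root D S g.
Hypothesis all_drawn : forall z, z \in root |: D.
Hypothesis SE : forall x, (x \in S) = internal e x.

Local Notation phi := (fold g).
Local Notation edge := (edge_set S g).

Let notS_D y : y \notin S -> y \in D.
Proof.
have := all_drawn y; rewrite in_setU1 => /predU1P[->|//].
by rewrite (s_rootS st).
Qed.

Let par_S y : y \in D -> par g y \in S. Proof. by move=> /(s_par st)[]. Qed.

Let adj_D y : y \in D -> e (par g y) y. Proof. by move=> /(s_par st)[]. Qed.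

Lemma adjP x y : e x y -> (y \in D /\ x = par g y) \/ (x \in D /\ y = par g x).
Proof. exact: (s_adj st (all_drawn x) (all_drawn y)). Qed.

(** Away from placed nodes the map is flat or creasy, and [vertex_point] excludes both. At a placed
    node all neighbours are now drawn, and its degree exceeds two, so [s_vertexy] applies. *)
Lemma vertex_pointP p : vertex_point phi p <-> exists2 x, x \in S & p = pos g x.
Proof.
split=> [[nu nc _]|[x xS ->]].
  apply: contrapT => np; have nx x : x \in S -> p <> pos g x.
    by move=> xS E; apply: np; exists x.
  have [[y [yD yp]]|ne] := pselect (exists y, y \in D /\ edge y p).
    by apply: nc; apply: creasy_crease; exact: (s_creasy st yD yp nx).
  apply: nu; apply: flat_unfolded; apply: (s_flat st) => y yD yp.
  by apply: ne; exists y.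
have [fs pg] := s_good st.
apply: (vertexy_vertex (s_cont st) pg); apply: (s_vertexy st xS).
have := xS; rewrite SE => /Hdeg[_]; rewrite /degree; congr (_ < _)%N.
by apply: eq_card => y; rewrite !inE; have := all_drawn y; rewrite !inE => ->.
Qed.

Lemma crease_pointP p : crease_point phi p <->
  (exists2 y, y \in D & edge y p) /\ forall x, x \in S -> p <> pos g x.
Proof.
split=> [cp|[[y yD yp] np]]; last by apply: creasy_crease; exact: (s_creasy st yD yp np).
split.
  apply: contrapT => ne; have [nu _] := cp; apply: nu.
  by apply: flat_unfolded; apply: (s_flat st) => y yD yp; apply: ne; exists y.
by move=> x xS E; have /vertex_pointP[_ nc _] : exists2 x, x \in S & p = pos g x by exists x.
Qed.

Lemma full_local_flat_folding : local_flat_folding phi.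
Proof.
split; first exact: (s_cont st).
- move=> p; have [[x xS xp]|np] := pselect (exists2 x, x \in S & p = pos g x).
    by constructor 3; apply/vertex_pointP; exists x.
  have [[y yD yp]|ne] := pselect (exists2 y, y \in D & edge y p).
    constructor 2; apply/crease_pointP; split; first by exists y.
    by move=> x xS E; apply: np; exists x.
  constructor 1; apply: flat_unfolded; apply: (s_flat st) => y yD yp.
  by apply: ne; exists y.
- by exists (pos g root); apply/vertex_pointP; exists root => //; exact: (s_rootS st).
Qed.

Lemma full_global_flat_folding : global_flat_folding phi.
Proof.
split; first exact: full_local_flat_folding.
have [fs pg] := s_good st; move=> eps eps0; exists (graph_lift phi); split.
  exact: graph_lift_embedding (s_cont st) pg.
by move=> p; rewrite vertical_proj_graph_lift edistpp ltW.
Qed.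

Lemma edge_param y t : y \in D ->
  edge y (pos g (par g y) + t *: dir g y) <-> 0 <= t /\ (y \in S -> t <= 1).
Proof.
move=> yD; have D0 := dotdd_gt0 (s_dir st yD).
have E : pos g (par g y) + t *: dir g y - pos g (par g y) = t *: dir g y by rewrite addrC addKr.
have dE : dot (dir g y) (t *: dir g y) = t * dot (dir g y) (dir g y).
  by rewrite /dot !ptE; ring.
rewrite /edge_set /ray /= E dE pmulr_lge0 // ger_pMl //; split=> [[[_ ?]]|[? ?]] //.
by split=> //; split=> //; rewrite /crs !ptE; ring.
Qed.

Lemma edge_exists y p : y \in D -> edge y p ->
  exists t, [/\ 0 <= t, y \in S -> t <= 1 & p = pos g (par g y) + t *: dir g y].
Proof.
move=> yD; have D0 := dotdd_gt0 (s_dir st yD); have Dn : dot (dir g y) (dir g y) != 0 by rewrite gt_eqF.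
move=> [[h1 h2] h3]; set v := pos g (par g y) in h1 h2 h3 *; set d := dir g y in D0 Dn h1 h2 h3 *.
exists (dot d (p - v) / dot d d); split.
- by rewrite divr_ge0 // ltW.
- by move=> /h3; rewrite ler_pdivrMr // mul1r.
- apply: (addIr (- v)); apply: (dot_crs_inj (s_dir st yD)); rewrite -/d shift_sub.
    have -> : dot d ((dot d (p - v) / dot d d) *: d) = dot d (p - v) / dot d d * dot d d.
      by move: (_ / _) => x; rewrite /dot !ptE; ring.
    by rewrite divfK.
  by rewrite h1 /crs !ptE; ring.
Qed.

Lemma near_not_edge y p : ~ edge y p -> \forall q \near p, ~ edge y q.
Proof.
set v := pos g (par g y); set d := dir g y => h.
have [c1|c1] := ltrP 0 (crs d (p - v)).
  by apply: filterS (near_crs_gt0 c1) => q hq [[E _] _]; rewrite -/v -/d in E; rewrite E ltxx in hq.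
have [c2|c2] := ltrP (crs d (p - v)) 0.
  by apply: filterS (near_crs_lt0 c2) => q hq [[E _] _]; rewrite -/v -/d in E; rewrite E ltxx in hq.
have c0 : crs d (p - v) = 0 by apply/eqP; rewrite eq_le c1 c2.
have [t1|t1] := ltrP (dot d (p - v)) 0.
  have := @near_dot_crs _ d v (-1) 0 0 p; rewrite mulN1r mul0r !addr0 oppr_gt0 => /(_ t1).
  apply: filterS => q; rewrite mulN1r mul0r !addr0 oppr_gt0 => hq [[_ E] _].
  by move: hq; rewrite ltNge E.
have [yS t2] : y \in S /\ dot d d < dot d (p - v).
  apply: contrapT => n; apply: h; split=> // yS; rewrite leNgt; apply/negP => t2.
  by apply: n.
have := @near_dot_crs _ d v 1 0 (- dot d d) p; rewrite mul1r mul0r addr0 subr_gt0 => /(_ t2).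
apply: filterS => q; rewrite mul1r mul0r addr0 subr_gt0 => hq [_ /(_ yS) E].
by move: hq; rewrite ltNge E.
Qed.

(** Creases leave a node only along its own edges: near [pos g u] only edges through that point are
    met, so a nearby crease point in direction [w] lies on one of them, and [u] is one of its two
    ends. *)
Lemma crease_direction u (w : P) (t0 : R) : u \in S -> w != 0 -> 0 < t0 ->
  (forall t, 0 < t < t0 -> crease_point phi (pos g u + t *: w)) ->
  exists y l, [/\ y \in D, 0 < l &
    (par g y = u /\ w = l *: dir g y) \/ (y = u /\ w = - l *: dir g y)].
Proof.
move=> uS w0 t00 hc.
have n : \forall q \near pos g u, forall y : T, ~ edge y (pos g u) -> ~ edge y q.
  apply: (@filter_forall _ _ (fun y q => ~ edge y (pos g u) -> ~ edge y q) _ (nbhs_filter _)) => y; have [h|h] := pselect (edge y (pos g u)).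
    by apply: nearW => q.
  by apply: filterS (near_not_edge h) => q hq _.
have [t1 t10 h1] := near_segment w n.
pose t := Num.min (t0 / 2) t1.
have tp : 0 < t by rewrite lt_min divr_gt0.
have tt0 : t < t0 by rewrite gt_min; apply/orP; left; lra.
(* One crease point is enough: together with [pos g u] it puts two distinct points on the edge of
   [y], which fixes the direction. *)
have /crease_pointP[[y yD yt] _] := hc t (introT andP (conj tp tt0)).
have yu : edge y (pos g u).
  apply: contrapT => /(h1 t) h; apply: h yt.
  by rewrite gtr0_norm // ge_min lexx orbT.
have d0 := s_dir st yD; have D0 := dotdd_gt0 d0; set d := dir g y in d0 D0.
have scale (m : R) : crs d w = 0 -> m * dot d d = dot d w -> w = m *: d.
  move=> cw mE; apply: (dot_crs_inj d0); first by rewrite -mE /dot !ptE; ring.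
  by rewrite cw /crs !ptE; ring.
have Dn : dot d d != 0 by rewrite gt_eqF.
pose m := dot d w / dot d d.
have mE : m * dot d d = dot d w by rewrite divfK.
have m0 : crs d w = 0 -> m != 0.
  by move=> cw; apply: contraNneq w0 => m0; rewrite (scale m) // m0 scale0r.
move: yt; rewrite /edge_set /ray /= -/d.
have [E|E] := s_pos_edge st uS yD yu.
- have -> : pos g u + t *: w - pos g (par g y) = d + t *: w.
    rewrite -E in yD; rewrite (s_pos st uS yD) /d E; apply: ptP; rewrite !ptE; ring.
  have -> : crs d (d + t *: w) = t * crs d w by rewrite /crs !ptE; ring.
  have -> : dot d (d + t *: w) = dot d d + t * dot d w by rewrite /dot !ptE; ring.
  move=> [[/eqP + _] +]; rewrite mulf_eq0 gt_eqF //= => /eqP cw.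
  rewrite -E => /(_ uS); rewrite gerDl pmulr_rle0 // -mE pmulr_lle0 // => mle.
  exists y, (- m); split=> //; first by rewrite oppr_gt0 lt_neqAle m0.
  by right; rewrite opprK; split=> //; exact: scale.
- have -> : pos g u + t *: w - pos g (par g y) = t *: w by rewrite E addrC addKr.
  have -> : crs d (t *: w) = t * crs d w by rewrite /crs !ptE; ring.
  have -> : dot d (t *: w) = t * dot d w by rewrite /dot !ptE; ring.
  move=> [[/eqP + +] _]; rewrite mulf_eq0 gt_eqF //= => /eqP cw.
  rewrite pmulr_rge0 // -mE pmulr_lge0 // => mge.
  exists y, m; split=> //; first by rewrite lt_neqAle eq_sym m0.
  by left; split=> //; exact: scale.
Qed.

Lemma pos_par_neq y : y \in D -> forall l, l != 0 -> pos g (par g y) <> pos g (par g y) + l *: dir g y.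
Proof.
move=> yD l l0 /esym/eqP; rewrite -subr_eq0 shift_sub scaler_eq0 (negbTE l0).
by rewrite (negbTE (s_dir st yD)).
Qed.

Lemma inner_crease y t : y \in D -> 0 < t -> (y \in S -> t < 1) ->
  crease_point phi (pos g (par g y) + t *: dir g y).
Proof.
move=> yD t0 t1; have yp : edge y (pos g (par g y) + t *: dir g y).
  by apply/edge_param => //; split; [exact: ltW | move=> /t1; exact: ltW].
apply/crease_pointP; split; first by exists y.
move=> x xS E; rewrite E in yp; have [xy|xy] := s_pos_edge st xS yD yp.
- rewrite xy in xS E; move: E; rewrite (s_pos st xS yD) => /addrI /eqP.
  rewrite -subr_eq0 -[X in _ - X]scale1r -scalerBl scaler_eq0 (negbTE (s_dir st yD)) orbF.
  by rewrite subr_eq0 lt_eqF // t1.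
- by rewrite xy in E; apply: (pos_par_neq yD (l := t)); rewrite ?gt_eqF.
Qed.

Lemma pos_not_crease x : x \in S -> ~ crease_point phi (pos g x).
Proof. by move=> xS /crease_pointP[_ /(_ x xS)]. Qed.

(** The segment starts along an edge at [u], and [l] is its length relative to that edge. If
    [l < 1], or if the edge is a free ray, [w] would be a crease point; if [l > 1], the other end of
    the edge would be one. So the segment is the edge. *)
Lemma segment_adj u w : u \in S -> w \in S -> pos g u <> pos g w ->
  (forall t : R, 0 < t < 1 -> crease_point phi ((1 - t) *: pos g u + t *: pos g w)) -> e u w.
Proof.
have [sym _ _ _] := He.
move=> uS wS uw hc; pose z := pos g w - pos g u.
have zE t : (1 - t) *: pos g u + t *: pos g w = pos g u + t *: z.
  by apply: ptP; rewrite /z !ptE; ring.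
have z0 : z != 0 by rewrite subr_eq0; apply/eqP => E; exact: uw.
have wE : pos g w = pos g u + z by rewrite /z addrC subrK.
have hc' t : 0 < t < 1 -> crease_point phi (pos g u + t *: z) by rewrite -zE; exact: hc.
have [y [l [yD l0 [[yu zl]|[yu zl]]]]] := crease_direction uS z0 ltr01 hc'.
- have [yS|yS] := boolP (y \in S); last first.
    exfalso; apply: (pos_not_crease wS); rewrite wE zl -yu; apply: inner_crease => //.
    by move=> yS'; rewrite yS' in yS.
  have [l1|l1|l1] := ltgtP l 1.
  + by exfalso; apply: (pos_not_crease wS); rewrite wE zl -yu; exact: inner_crease.
  + exfalso; apply: (pos_not_crease yS); rewrite (s_pos st yS yD) yu.
    have -> : dir g y = l^-1 *: z by rewrite zl scalerA mulVf ?gt_eqF // scale1r.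
    by apply: hc'; rewrite invr_gt0 l0 invf_lt1.
  + have -> : w = y by apply: (s_inj st wS yS); rewrite wE zl l1 scale1r (s_pos st yS yD) yu.
    by rewrite -yu; exact: adj_D.
- rewrite yu in yD zl; have pS := par_S yD.
  have uE := s_pos st uS yD.
  have [l1|l1|l1] := ltgtP l 1.
  + exfalso; apply: (pos_not_crease wS).
    have -> : pos g w = pos g (par g u) + (1 - l) *: dir g u.
      by rewrite wE zl uE; apply: ptP; rewrite !ptE; ring.
    by apply: inner_crease => // [|_]; lra.
  + exfalso; apply: (pos_not_crease pS).
    have -> : pos g (par g u) = pos g u + l^-1 *: z.
      rewrite zl uE scalerA mulrN mulVf ?gt_eqF //.
      by apply: ptP; rewrite !ptE; ring.
    by apply: hc'; rewrite invr_gt0 l0 invf_lt1.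
  + have -> : w = par g u; last by rewrite sym; exact: adj_D.
    by apply: (s_inj st wS pS); rewrite wE zl l1 uE; apply: ptP; rewrite !ptE; ring.
Qed.

Lemma adj_segment u w : u \in S -> w \in S -> e u w -> pos g u <> pos g w /\
  forall t : R, 0 < t < 1 -> crease_point phi ((1 - t) *: pos g u + t *: pos g w).
Proof.
have [_ irr _ _] := He.
move=> uS wS uw; split.
  by move=> /(s_inj st uS wS) E; rewrite E irr in uw.
move=> t /andP[t0 t1]; have [[wD E]|[uD E]] := adjP uw.
- have -> : (1 - t) *: pos g u + t *: pos g w = pos g (par g w) + t *: dir g w.
    by rewrite (s_pos st wS wD) E; apply: ptP; rewrite !ptE; ring.
  exact: inner_crease.
- have -> : (1 - t) *: pos g u + t *: pos g w = pos g (par g u) + (1 - t) *: dir g u.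
    by rewrite (s_pos st uS uD) E; apply: ptP; rewrite !ptE; ring.
  by apply: inner_crease => // [|_]; lra.
Qed.

Lemma leaf_edgeE y : y \notin S ->
  edge y = [set pos g (par g y) + t *: dir g y | t in [set t : R | 0 <= t]].
Proof.
move=> yS; have yD := notS_D yS; apply/seteqP; split=> p.
  by move=> /(edge_exists yD)[t [t0 _ ->]]; exists t.
by move=> [t /= t0 <-]; apply/edge_param => //; split=> //; rewrite (negbTE yS).
Qed.

Lemma leaf_ray_from y : y \notin S -> ray_from (pos g (par g y)) (edge y).
Proof. by move=> yS; exists (dir g y); [exact: (s_dir st (notS_D yS)) | exact: leaf_edgeE]. Qed.

Lemma leaf_crease_ray y : y \notin S -> crease_ray phi (edge y).
Proof.
move=> yS; have yD := notS_D yS; exists (pos g (par g y)); split.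
- exact: leaf_ray_from.
- by apply/vertex_pointP; exists (par g y) => //; exact: par_S.
- move=> p; rewrite leaf_edgeE // => -[t /= t0 <-] tp; apply: inner_crease => //.
    rewrite lt_neqAle t0 andbT eq_sym; apply/eqP => E; apply: tp.
    by rewrite E scale0r addr0.
  by rewrite (negbTE yS).
Qed.

(** A ray starting along an edge with a placed node at its other end would run through that node,
    which is a vertex and not a crease point. *)
Lemma crease_ray_leaf r : crease_ray phi r -> exists2 y, y \notin S & r = edge y.
Proof.
move=> [a [[w w0 rE] /vertex_pointP[u uS aE] hr]].
have inr t : 0 < t -> crease_point phi (pos g u + t *: w).
  move=> t0; rewrite -aE; apply: hr; first by rewrite rE; exists t => //=; exact: ltW.
  move=> /eqP; rewrite -subr_eq0 shift_sub scaler_eq0 (negbTE w0) orbF.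
  by rewrite gt_eqF.
have [y [l [yD l0 [[yu wl]|[yu wl]]]]] :=
  crease_direction uS w0 ltr01 (fun t h => inr t (proj1 (andP h))).
- have dE : dir g y = l^-1 *: w by rewrite wl scalerA mulVf ?gt_eqF // scale1r.
  have yS : y \notin S.
    apply/negP => yS; apply: (pos_not_crease yS); rewrite (s_pos st yS yD) yu dE.
    by apply: inr; rewrite invr_gt0.
  exists y => //; rewrite leaf_edgeE // yu rE aE; apply/seteqP; split=> p [t /= t0 <-].
    by exists (t * l); [rewrite /= mulr_ge0 // ltW | rewrite wl scalerA].
  by exists (t * l^-1); [rewrite /= mulr_ge0 // invr_ge0 ltW | rewrite dE scalerA].
- exfalso; rewrite yu in yD wl; apply: (pos_not_crease (par_S yD)).
  have -> : pos g (par g u) = pos g u + l^-1 *: w.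
    rewrite wl (s_pos st uS yD) scalerA mulrN mulVf ?gt_eqF //.
    by apply: ptP; rewrite !ptE; ring.
  by apply: inr; rewrite invr_gt0.
Qed.

(** Different edges meet only at placed nodes, but the point at parameter 1 of a free ray is not a
    placed node. *)
Lemma leaf_edge_inj y z : y \notin S -> z \notin S -> edge y = edge z -> y = z.
Proof.
move=> yS zS E; apply: contrapT => yz.
have yD := notS_D yS; have zD := notS_D zS.
have yp : edge y (pos g (par g y) + 1 *: dir g y).
  by apply/edge_param.
have zp := yp; rewrite E in zp; have [x xS xE] := s_edge_edge st yD zD yz yp zp.
rewrite xE in yp; have [xy|xy] := s_pos_edge st xS yD yp.
  by rewrite -xy xS in yS.
by apply: (pos_par_neq yD (oner_neq0 R)); rewrite xE xy.
Qed.

Lemma ray_from_apex (a b : P) r : ray_from a r -> ray_from b r -> a = b.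
Proof.
move=> [u u0 ra] [w w0 rb].
have [s s0 sE] : exists2 s, 0 <= s & b + s *: w = a.
  have : r a by rewrite ra; exists 0 => //=; rewrite scale0r addr0.
  by rewrite rb => -[s s0 <-]; exists s.
have [t t0 tE] : exists2 t, 0 <= t & a + t *: u = b.
  have : r b by rewrite rb; exists 0 => //=; rewrite scale0r addr0.
  by rewrite ra => -[t t0 <-]; exists t.
(* A point one further [w] beyond [a] shows that [w] is a nonnegative multiple of [u]. Going from
   [a] to [b] and back is then a sum of nonnegative multiples of [u], so both are zero. *)
have [m m0 mE] : exists2 m, 0 <= m & a + m *: u = b + (s + 1) *: w.
  have : r (b + (s + 1) *: w) by rewrite rb; exists (s + 1) => //=; rewrite addr_ge0.
  by rewrite ra => -[m m0 <-]; exists m.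
have wm : w = m *: u.
  by apply: (addrI a); rewrite mE scalerDl scale1r addrA sE.
have : (s * m + t) *: u = 0.
  apply: (addrI b); rewrite addr0 scalerDl -scalerA -wm addrA sE tE //.
move/eqP; rewrite scaler_eq0 (negbTE u0) orbF paddr_eq0 ?mulr_ge0 //.
by move=> /andP[_ /eqP t00]; rewrite -tE t00 scale0r addr0.
Qed.

Lemma leaf_adj u y : u \in S -> y \notin S -> e u y <-> ray_from (pos g u) (edge y).
Proof.
move=> uS yS; have yD := notS_D yS; split=> [uy|h].
  have [[_ ->]|[uD E]] := adjP uy; first exact: leaf_ray_from.
  by rewrite E par_S in yS.
have /(s_inj st uS (par_S yD)) -> := ray_from_apex h (leaf_ray_from yS).
exact: adj_D.
Qed.

Definition node_image x : truncated_vertex phi :=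
  match pselect (x \in S) with
  | left xS => inl (exist _ (pos g x) (proj2 (vertex_pointP _) (ex_intro2 _ _ x xS erefl)))
  | right xS => inr (exist _ (edge x) (leaf_crease_ray (introN idP xS)))
  end.

Lemma node_imageS x : x \in S -> exists H, node_image x = inl (exist _ (pos g x) H).
Proof. by move=> xS; rewrite /node_image; case: pselect => // xS'; eexists. Qed.

Lemma node_imageN x : x \notin S -> exists H, node_image x = inr (exist _ (edge x) H).
Proof.
by move=> /negP xS; rewrite /node_image; case: pselect => // xS'; eexists.
Qed.

Lemma full_realized : realized_by e phi.
Proof.
have [sym _ _ _] := He; exists node_image; split.
  have surj (z : truncated_vertex phi) : exists x, node_image x = z.
    case: z => [[p vp]|[r cr]].
      have [x xS xE] := (vertex_pointP p).1 vp.
      exists x; have [H ->] := node_imageS xS; congr inl.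
      by move: vp; rewrite xE => vp; congr exist; exact: Prop_irrelevance.
    have [y yS yE] := crease_ray_leaf cr.
    exists y; have [H ->] := node_imageN yS; congr inr.
    by move: cr; rewrite yE => cr; congr exist; exact: Prop_irrelevance.
  have inj : injective node_image.
    move=> x y; have [xS|xS] := boolP (x \in S); have [yS|yS] := boolP (y \in S).
    - have [H ->] := node_imageS xS; have [H' ->] := node_imageS yS => -[E].
      exact: (s_inj st xS yS).
    - by have [H ->] := node_imageS xS; have [H' ->] := node_imageN yS.
    - by have [H ->] := node_imageN xS; have [H' ->] := node_imageS yS.
    - have [H ->] := node_imageN xS; have [H' ->] := node_imageN yS => -[E].
      exact: leaf_edge_inj.
  exists (fun z => projT1 (cid (surj z))) => [x|z].
    by apply: inj; case: cid.
  by case: cid.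
move=> x y; have [xS|xS] := boolP (x \in S); have [yS|yS] := boolP (y \in S).
- have [H ->] := node_imageS xS; have [H' ->] := node_imageS yS => /=; split.
    exact: adj_segment.
  by move=> [xy hc]; exact: segment_adj.
- by have [H ->] := node_imageS xS; have [H' ->] := node_imageN yS => /=; exact: leaf_adj.
- have [H ->] := node_imageN xS; have [H' ->] := node_imageS yS => /=.
  by rewrite sym; exact: leaf_adj.
(* Two leaves are never adjacent: one would be the parent of the other, and parents are placed. *)
- have [H ->] := node_imageN xS; have [H' ->] := node_imageN yS => /=; split=> // xy.
  have [[yD E]|[xD E]] := adjP xy.
    by rewrite E par_S in xS.
  by rewrite E par_S in yS.
Qed.


End Realization.

Theorem theorem3 (R : realType) (T : finType) (e : rel T)
    (He : is_tree e)
    (Hint : exists x : T, internal e x)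
    (Hdeg : forall x : T, internal e x ->
       ~~ odd (degree e x) /\ (2 < degree e x)%N) :
  exists phi : 'rV[R]_2 -> 'rV[R]_2,
    global_flat_folding phi /\ realized_by e phi.
Proof.
have [root ri] := Hint.
have [D [S [g [st all_drawn SE]]]] := exists_full_state R He Hdeg ri.
exists (fold g); split.
- exact: (full_global_flat_folding Hdeg st all_drawn SE).
- exact: (full_realized He Hdeg st all_drawn SE).
Qed.
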